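(* Let $n \ge 1$ be an integer and let $K \subset \mathbb{R}^n$ be the limit set of a self-similar iterated function system containing no rotations or reflections and satisfying the strong separation condition. For $e \in \mathbb{S}^{n-1}$, let $K_e := \rho_e(K)$, where $\rho_e$ is the orthogonal projection of $\mathbb{R}^n$ onto the hyperplane orthogonal to $e$. Then, for all $0 \le s < \dim K$, $$\dim_P \{ e \in \mathbb{S}^{n-1} : \dim K_e \le s \} \le s.$$
   Context: A self-similar iterated function system (IFS) on $\mathbb{R}^n$ containing no rotations or reflections is a finite family $(g_i)_{i=1}^N$ of maps of the form $g_i(x) = a_i x + b_i$ with $a_i \in (0,1)$ and $b_i \in \mathbb{R}^n$. Its limit set is the unique nonempty compact $K$ with $K = \bigcup_{i=1}^N g_i(K)$. The IFS satisfies the strong separation condition (SSC) if the sets $g_i(K)$, $i = 1,\dots,N$, are pairwise disjoint. The projection is $\rho_e(x) = x - (x\cdot e)e$. $\mathbb{S}^{n-1}$ is the unit sphere of $\mathbb{R}^n$ with its usual metric. $\dim$ denotes Hausdorff dimension. For a bounded subset $B$ of a metric space $X$ and $\delta > 0$, $N(B,\delta)$ is the least number of closed balls of radius $\delta$ needed to cover $B$, and $\overline{\dim}_B B := \inf\{ r \ge 0 : \limsup_{\delta \downarrow 0} N(B,\delta)\delta^r = 0\}$ is the upper box dimension. The packing dimension of $B \subseteq X$ is $\dim_P B := \inf\{ \sup_{i} \overline{\dim}_B B_i : B = \bigcup_{i=1}^\infty B_i,\ B_i \text{ bounded} \}$. *)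

(* Defs.v *)
From HB Require Import structures.
From mathcomp Require Import all_boot all_order all_algebra.
From mathcomp Require Import all_classical all_reals all_analysis.
From mathcomp Require Import ring lra.
Import Order.TTheory GRing.Theory Num.Theory.
Import numFieldTopology.Exports.

Set Implicit Arguments.
Unset Strict Implicit.
Unset Printing Implicit Defensive.

Local Open Scope classical_set_scope.
Local Open Scope ring_scope.

(** Row vectors under another name: the canonical metric structure on
    ['rV[R]_n] comes from the sup norm, whereas [euclidean R n] carries the
    Euclidean distance. *)
Definition euclidean (R : realType) (n : nat) : Type := 'rV[R]_n.

HB.instance Definition _ (R : realType) (n : nat) :=
  GRing.Lmodule.on (euclidean R n).

Definition dotv (R : realType) (n : nat) (x y : euclidean R n) : R :=
  \sum_(i < n) (x : 'rV[R]_n) 0 i * (y : 'rV[R]_n) 0 i.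

Definition l2norm (R : realType) (n : nat) (x : euclidean R n) : R :=
  Num.sqrt (dotv x x).

Section euclidean_metric.
Context {R : realType} {n : nat}.
Implicit Types (a : R) (x y z : euclidean R n).

Lemma dotvC x y : dotv x y = dotv y x.
Proof. by apply: eq_bigr => i _; rewrite mulrC. Qed.

Lemma dotvDl x y z : dotv (x + y) z = dotv x z + dotv y z.
Proof. by rewrite -big_split; apply: eq_bigr => i _; rewrite mxE mulrDl. Qed.

Lemma dotvZl a x y : dotv (a *: x) y = a * dotv x y.
Proof. by rewrite mulr_sumr; apply: eq_bigr => i _; rewrite mxE mulrA. Qed.

Lemma dotvDr x y z : dotv x (y + z) = dotv x y + dotv x z.
Proof. by rewrite dotvC dotvDl !(dotvC x). Qed.

Lemma dotvZr a x y : dotv x (a *: y) = a * dotv x y.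
Proof. by rewrite dotvC dotvZl (dotvC x). Qed.

Lemma dotvv_ge0 x : 0 <= dotv x x.
Proof. by apply: sumr_ge0 => i _; rewrite -expr2 sqr_ge0. Qed.

Lemma dotvv_eq0 x : dotv x x = 0 -> x = 0.
Proof.
move=> /eqP; rewrite psumr_eq0; last by move=> i _; rewrite -expr2 sqr_ge0.
move=> /allP x0; apply/rowP => i; rewrite mxE.
by have := x0 i (mem_index_enum i); rewrite /= -expr2 sqrf_eq0 => /eqP.
Qed.

Lemma cauchy_schwarz x y : dotv x y ^+ 2 <= dotv x x * dotv y y.
Proof.
have [y0|y0] := eqVneq (dotv y y) 0.
  have -> : y = 0 *: y by rewrite scale0r; exact: dotvv_eq0.
  by rewrite !dotvZr !mul0r expr0n /= mulr0.
have yp : 0 < dotv y y by rewrite lt_neqAle eq_sym y0 dotvv_ge0.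
have := dotvv_ge0 (dotv y y *: x + (- dotv x y) *: y).
rewrite !(dotvDl, dotvDr, dotvZl, dotvZr) (dotvC y x).
move: (dotv x x) (dotv x y) (dotv y y) yp => a b c c0 h.
have : 0 <= c * (a * c - b ^+ 2) by move: h; congr (_ <= _); ring.
by rewrite pmulr_rge0// subr_ge0.
Qed.

Lemma l2normD x y : l2norm (x + y) <= l2norm x + l2norm y.
Proof.
rewrite -(@ler_pXn2r _ 2)// ?nnegrE ?addr_ge0 ?sqrtr_ge0// sqrrD.
rewrite !sqr_sqrtr ?dotvv_ge0// !(dotvDl, dotvDr) (dotvC y x).
suff : dotv x y <= l2norm x * l2norm y by rewrite mulr2n; lra.
rewrite (le_trans (ler_norm _))// -sqrtr_sqr -sqrtrM ?dotvv_ge0//.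
exact/ler_wsqrtr/cauchy_schwarz.
Qed.

Lemma l2normN x : l2norm (- x) = l2norm x.
Proof. by rewrite /l2norm -scaleN1r dotvZl dotvZr !mulN1r opprK. Qed.

Let dist x y := l2norm (x - y).

Let distxx x : dist x x = 0.
Proof. by rewrite /dist subrr -(scale0r 0) /l2norm dotvZl mul0r sqrtr0. Qed.

Let dist_positivity x y : dist x y = 0 -> x = y.
Proof.
move=> /eqP; rewrite sqrtr_eq0 => xy; apply/eqP; rewrite -subr_eq0.
by apply/eqP/dotvv_eq0/eqP; rewrite eq_le xy dotvv_ge0.
Qed.

Let dist_sym x y : dist x y = dist y x.
Proof. by rewrite /dist -opprB l2normN. Qed.

Let dist_triangle y x z : dist x z <= dist x y + dist y z.
Proof. by rewrite (le_trans _ (l2normD _ _))// subrKA. Qed.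

HB.instance Definition _ := isMetric.Build R (euclidean R n)
  distxx dist_positivity dist_sym dist_triangle.

End euclidean_metric.

Section set_type_metric.
Context {R : realType} {X : metricType R} (A : set X).

Let dist (x y : A) : R := mdist (set_val x) (set_val y).

Let dist_ge0 x y : 0 <= dist x y.
Proof. exact: mdist_ge0. Qed.

Let dist_positivity x y : dist x y = 0 -> x = y.
Proof. by move=> /mdist_positivity; exact: val_inj. Qed.

Let ballEdist x d : ball x d = [set y | dist x y < d].
Proof. by rewrite -initial_ballE ballEmdist. Qed.

HB.instance Definition _ := PseudoMetric_isMetric.Build R (A : Type)
  dist_ge0 dist_positivity ballEdist.

End set_type_metric.

Definition sphere (R : realType) (n : nat) : set (euclidean R n) :=
  [set x | l2norm x = 1].
Arguments sphere : clear implicits.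

Section dimensions.
Context {R : realType} {T : metricType R}.
Implicit Types (A B U : set T).

(** The union with [[set 0]] only matters for [U = set0]. *)
Definition diam U : \bar R :=
  ereal_sup ([set 0%E] `|` [set (mdist x y)%:E | x in U & y in U]).

(** [diam U ^ s], with the convention that the empty set contributes [0] also
    when [s = 0] (whereas [0 `^ 0 = 1], so that the case [s = 0] counts
    points). *)
Definition hausdorff_gauge (s : R) U : \bar R :=
  if U == set0 then 0%E else (diam U `^ s)%E.

Definition hausdorff_content (s delta : R) A : \bar R :=
  ereal_inf [set (\sum_(0 <= i <oo) hausdorff_gauge s (U i))%E |
    U in [set U : nat -> set T |
           A `<=` \bigcup_i U i /\ forall i, (diam (U i) <= delta%:E)%E]].

Definition hausdorff_measure (s : R) A : \bar R :=
  ereal_sup [set hausdorff_content s delta A | delta in [set delta | 0 < delta]].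

Definition hausdorff_dim A : \bar R :=
  ereal_inf [set s%:E | s in [set s | 0 <= s /\ hausdorff_measure s A = 0%E]].

(** The library's [closed_ball] is the closure of the open ball, which can be
    smaller in a general metric space. *)
Definition metric_closed_ball (x : T) (delta : R) : set T :=
  [set y | mdist x y <= delta].

(** [+oo] if no finite family of such balls covers [B]. *)
Definition covering_number B (delta : R) : \bar R :=
  ereal_inf [set k%:R%:E | k in [set k : nat |
    exists c : 'I_k -> T,
      B `<=` \bigcup_(i in [set: 'I_k]) metric_closed_ball (c i) delta]].

Definition upper_box_dim B : \bar R :=
  ereal_inf [set r%:E | r in [set r | 0 <= r /\
    limf_esup (fun delta : R => (covering_number B delta * (delta `^ r)%:E)%E)
      0^'+ = 0%E]].

Definition metric_bounded B : Prop :=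
  exists M : R, forall x y, B x -> B y -> mdist x y <= M.

Definition packing_dim B : \bar R :=
  ereal_inf [set ereal_sup (range (fun i => upper_box_dim (F i))) |
    F in [set F : nat -> set T |
           B = \bigcup_i F i /\ forall i, metric_bounded (F i)]].

End dimensions.

Section self_similar.
Context {R : realType} {n : nat}.

Definition homothety (a : R) (b x : euclidean R n) : euclidean R n :=
  a *: x + b.

Definition is_limit_set (N : nat) (g : 'I_N -> euclidean R n -> euclidean R n)
    (K : set (euclidean R n)) : Prop :=
  [/\ K !=set0, compact K & K = \bigcup_(i in [set: 'I_N]) (g i @` K)].

Definition strong_separation (N : nat)
    (g : 'I_N -> euclidean R n -> euclidean R n)
    (K : set (euclidean R n)) : Prop :=
  forall i j : 'I_N, i != j -> (g i @` K) `&` (g j @` K) = set0.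

Definition proj_perp (e x : euclidean R n) : euclidean R n :=
  x - dotv x e *: e.

End self_similar.

(* Main.v *)
Require Import Defs.
From mathcomp Require Import all_boot all_order all_algebra.
From mathcomp Require Import all_classical all_reals all_analysis.
From mathcomp Require Import ring lra.
Import Order.TTheory GRing.Theory Num.Theory.

(** Write [K_e] for the projection of [K] along the unit vector [e], and fix
    [t] with [s < t < dim K]. A packing dimension is bounded by splitting the
    set of exceptional directions into countably many strata and bounding the
    upper box dimension of each of them.

    The strata ([direction_stratum]). Fix a small [h > 0]. For an exceptional
    [e] let [s0 < dim K_e <= s1] with [s0 = j h] and [s1 = s0 + h] ([s0 = 0]
    when [dim K_e = 0]). A set of Hausdorff dimension larger than [s0] needs
    at least [delta ^ (- s0)] balls of every sufficiently small radius [delta]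
    ([hausdorff_dim_gt_cover]). Conversely [K_e] is itself self-similar:
    [K_e] contains copies of itself near each of its points, so [M] separated
    copies of [K] of size about [q] in [K_e] force a dimension of at least
    [log M / log (1 / q)], up to a constant factor inside the logarithms. Hence
    [dim K_e <= s1] bounds the number of separated copies at every scale, with a
    constant that depends neither on [e] nor on the scale
    ([separated_pieces_card]).

    Entropy of directions at one scale ([direction_entropy]). Let [e0] be in a
    stratum, [q] small, [tau = q ^ theta], [r = tau q] and [delta = tau q ^ 2].
    Let [c] be a set of directions of the stratum within [r] of [e0] that is
    separated at distance of order [q ^ 2]. Consider the points of [K] obtained
    by composing three homotheties [v], [u], [z] from the semigroup of the
    system: [v] runs over the pieces of size [tau], whose number is at least of
    the order of [tau ^ (- t)] as [t < dim K], while [u] and [z] run over a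
    maximal set [U] of pieces of size [q] that are well separated as seen in the
    direction [e0], so [|U|] is at least about [q ^ (- s0)]. Since each [K_e],
    [e] in [c], is covered by about [delta ^ (- s1)] balls of radius [delta],
    the Cauchy-Schwarz inequality gives many pairs of points that are
    [delta]-close in the direction [e]. These pairs are rare when [e] varies
    ([sum_close_pairs], [direction_count]). Points with the same [v] are never
    close, as [U] is separated. Points with different [v] are at distance at
    least [d0 tau] by strong separation, so that the directions in which they
    are [delta]-close form two antipodal caps of radius about [q ^ 2], which
    contain at most one element of [c] ([sphere_close]); besides, they have to
    be [r]-close in the direction [e0], which determines the second [u] from the
    other data. Comparing the two estimates yields
    [|c| <= C q ^ (s0 - (2 + theta) s1)];
    the condition [t > s1] guarantees that the trivial pairs do not
    dominate, provided [h] is small relative to [theta (t - s1)].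

    From one scale to all scales ([covered_iteration]). The last bound says that
    the part of a stratum in a ball of radius [q ^ (1 + theta)] is covered by
    [C q ^ (- (1 + theta) s1 - h)] balls of radius [q ^ (2 - theta)]. Iterating
    down the scales gives the upper box dimension of the stratum, which is at
    most [((1 + theta) s1 + h) / (1 - 2 theta)]. This is as close to [s] as
    desired when [theta], and then [h], are small. *)

Set Implicit Arguments.
Unset Strict Implicit.
Unset Printing Implicit Defensive.

Local Open Scope classical_set_scope.
Local Open Scope ring_scope.

(** * Hausdorff dimension and covers *)

Section hausdorff_covers.
Context {R : realType} {T : metricType R}.
Implicit Types (A U : set T) (s t delta eps : R).

Lemma diam_ge0 U : (0 <= diam U)%E.
Proof. by apply: ereal_sup_ubound; left. Qed.

Lemma mdist_le_diam U x y : U x -> U y -> ((mdist x y)%:E <= diam U)%E.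
Proof.
by move=> Ux Uy; apply: ereal_sup_ubound; right; exists x => //; exists y.
Qed.

Lemma diam_le U delta : 0 <= delta ->
  (forall x y, U x -> U y -> mdist x y <= delta) -> (diam U <= delta%:E)%E.
Proof.
move=> d0 Ud; apply: ub_ereal_sup => _ [->|[x Ux [y Uy <-]]].
  by rewrite lee_fin.
by rewrite lee_fin Ud.
Qed.

Lemma hausdorff_gauge_ge0 s U : (0 <= hausdorff_gauge s U)%E.
Proof. by rewrite /hausdorff_gauge; case: ifP => // _; exact: poweR_ge0. Qed.

Lemma hausdorff_content_ge0 s delta A : (0 <= hausdorff_content s delta A)%E.
Proof.
apply: le_ereal_inf_tmp => _ [U _ <-].
by apply: nneseries_ge0 => i _ _; exact: hausdorff_gauge_ge0.
Qed.

Lemma powR_le_hausdorff_gauge s t U (d : R) : 0 <= s -> s <= t -> 0 < t ->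
  diam U = d%:E -> 0 <= d -> d <= 1 -> ((d `^ t)%:E <= hausdorff_gauge s U)%E.
Proof.
move=> s0 st t0 Ud d0 d1; rewrite /hausdorff_gauge.
case: eqP => [U0|_].
  have -> : d = 0.
    apply/eqP; rewrite eq_le d0 andbT -lee_fin -Ud U0.
    by apply: diam_le.
  by rewrite powR0// gt_eqF.
rewrite Ud poweR_EFin lee_fin.
have [->|dn0] := eqVneq d 0; first by rewrite powR0 ?powR_ge0// gt_eqF.
by apply: ger_powR; rewrite // lt_neqAle eq_sym dn0 d0.
Qed.

Lemma sum_half_le1 k : \sum_(0 <= i < k) (2^-1 : R) ^+ i.+1 <= 1.
Proof.
suff -> : \sum_(0 <= i < k) (2^-1 : R) ^+ i.+1 = 1 - 2^-1 ^+ k.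
  by rewrite gerBl exprn_ge0// invr_ge0.
elim: k => [|k IH]; first by rewrite big_geq// expr0 subrr.
by rewrite big_nat_recr//= IH [in RHS]exprS exprS; field.
Qed.

(** Every exponent [t] above the dimension admits covers with arbitrarily small
    sum of [t]-th powers of sizes. The sizes [rho i] are positive and strictly
    exceed the distances in [U i], which leaves room to enlarge [U i] to an open
    set. *)
Lemma hausdorff_dim_le_cover A s t eps :
  (hausdorff_dim A <= s%:E)%E -> s < t -> 0 < eps ->
  exists (U : nat -> set T) (rho : nat -> R),
    [/\ A `<=` \bigcup_i U i, forall i, 0 < rho i,
        forall i x y, U i x -> U i y -> mdist x y < rho i &
        forall k, \sum_(0 <= i < k) rho i `^ t <= eps].
Proof.
move=> As st e0.
have : (hausdorff_dim A < t%:E)%E by rewrite (le_lt_trans As)// lte_fin.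
move=> /ereal_inf_lt[_ [r [r0 Ar] <-]]; rewrite lte_fin => rt.
have t0 : 0 < t := le_lt_trans r0 rt.
have e20 : 0 < eps / 2 by rewrite divr_gt0.
have : (hausdorff_content r 1 A < (eps / 2)%:E)%E.
  rewrite (@le_lt_trans _ _ 0%E) ?lte_fin// -Ar.
  by apply: ereal_sup_ubound; exists 1 => //=.
move=> /ereal_inf_lt[_ [U [AU Ud] <-]] Ue.
have dfin i : exists2 d : R, diam (U i) = d%:E & 0 <= d <= 1.
  have := diam_ge0 (U i); have := Ud i.
  case: (diam (U i)) => // d; rewrite !lee_fin => d1 d0.
  by exists d; rewrite ?d0.
pose d i := sval (cid2 (dfin i)).
have dE i : diam (U i) = (d i)%:E by rewrite /d; case: cid2.
have d01 i : 0 <= d i <= 1 by rewrite /d; case: cid2.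
(* Enlarging the [t]-th powers by a geometric series of sum at most [eps / 2]
   makes all the sizes positive. *)
pose w i : R := d i `^ t + eps / 2 * 2^-1 ^+ i.+1.
have wd i : d i `^ t < w i by rewrite /w ltrDl mulr_gt0// exprn_gt0.
have w0 i : 0 < w i by rewrite (le_lt_trans _ (wd i))// powR_ge0.
have wK i : (w i `^ t^-1) `^ t = w i.
  by rewrite -powRrM mulVf ?gt_eqF// powRr1// ltW.
exists U, (fun i => w i `^ t^-1); split => //.
- by move=> i; rewrite powR_gt0.
- move=> i x y Ux Uy.
  have : mdist x y <= d i by rewrite -lee_fin -dE mdist_le_diam.
  move=> /le_lt_trans; apply.
  rewrite ltNge; apply/negP => /(ge0_ler_powR (ltW t0)).
  rewrite !nnegrE powR_ge0 => /(_ isT); case/andP: (d01 i) => -> _ /(_ isT).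
  by rewrite wK leNgt wd.
- move=> k; under eq_bigr do rewrite wK.
  rewrite big_split/= -mulr_sumr [leRHS](splitr eps) lerD//; last first.
    by rewrite ler_piMr ?sum_half_le1// ltW.
  rewrite -lee_fin -sumEFin (le_trans _ (ltW Ue))//.
  apply: le_trans (nneseries_lim_ge k _) => /=; last first.
    by move=> i _ _; exact: hausdorff_gauge_ge0.
  apply: lee_sum => i _; apply: powR_le_hausdorff_gauge => //; last 2 first.
  + by case/andP: (d01 i).
  + by case/andP: (d01 i).
  by rewrite ltW.
Qed.

(** The lower box dimension is at least the Hausdorff dimension. *)
Lemma hausdorff_dim_gt_cover A s : 0 <= s -> (s%:E < hausdorff_dim A)%E ->
  exists2 delta0, 0 < delta0 & forall delta (c : seq T), 0 < delta < delta0 ->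
    (forall x, A x -> exists2 y, y \in c & mdist y x <= delta) ->
    delta `^ (- s) <= (size c)%:R.
Proof.
move=> s0 sA; apply: contrapT => /forall2NP H.
suff : (hausdorff_dim A <= s%:E)%E by rewrite leNgt sA.
apply/lee_addgt0Pr => eta eta0; rewrite -EFinD.
apply: ereal_inf_lbound; exists (s + eta) => //; split.
  by rewrite addr_ge0// ltW.
have se0 : 0 < s + eta by rewrite ltr_wpDl.
apply/eqP; rewrite eq_le; apply/andP; split; last first.
  apply: (@le_trans _ _ (hausdorff_content (s + eta) 1 A)).
    exact: hausdorff_content_ge0.
  by apply: ereal_sup_ubound; exists 1 => //=.
apply: ub_ereal_sup => _ [delta d0 <-].
apply/lee_addgt0Pr => eps eps0; rewrite add0e.
have c0 : 0 < 2 `^ (s + eta) :> R by rewrite powR_gt0.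
pose delta0 := Num.min (delta / 2) ((eps / 2 `^ (s + eta)) `^ eta^-1).
have delta00 : 0 < delta0 by rewrite lt_min divr_gt0//= powR_gt0// divr_gt0.
case: (H delta0) => // /existsNP[r /existsNP[c]].
move=> /not_implyP[/andP[r0 rd]] /not_implyP[Ac /negP]; rewrite -ltNge => cr.
(* The default value of [nth] is irrelevant as [i < size c]. *)
pose U i : set T := if (i < size c)%N
  then [set x | exists2 y, y = nth x c i & mdist y x <= r] else set0.
have Ur i x y : U i x -> U i y -> mdist x y <= 2 * r.
  rewrite /U; case: ifPn => // ic [a -> ax] [b -> yb].
  rewrite (set_nth_default x y) // in yb.
  rewrite (le_trans (metric_triangle _ (nth x c i) _))// metric_sym.
  by rewrite mulr2n mulrDl mul1r lerD.
have r20 : 0 <= 2 * r by rewrite mulr_ge0// ltW.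
have r2 : 2 * r <= delta.
  have : r < delta / 2 by rewrite (lt_le_trans rd)// ge_min lexx.
  by lra.
apply: (@le_trans _ _ (\sum_(0 <= i <oo) hausdorff_gauge (s + eta) (U i))%E).
  apply: ereal_inf_lbound; exists U => //; split.
    move=> x /Ac[y yc xy]; exists (index y c) => //; rewrite /U index_mem yc.
    by exists y => //; rewrite nth_index.
  move=> i; apply: diam_le => [|x y Ux Uy]; first exact: ltW.
  exact: le_trans (Ur i x y Ux Uy) r2.
rewrite (nneseries_split 0 (size c)); last first.
  by move=> *; exact: hausdorff_gauge_ge0.
rewrite add0n eseries0 ?adde0; last first.
  move=> i ci _; rewrite /hausdorff_gauge.
  suff -> : U i = set0 by rewrite eqxx.
  by rewrite /U ltnNge ci.
apply: (@le_trans _ _ (\sum_(0 <= i < size c) ((2 * r) `^ (s + eta))%:E)%E).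
  apply: lee_sum => i _; rewrite /hausdorff_gauge.
  case: ifP => _; first by rewrite lee_fin powR_ge0.
  have := @diam_le (U i) (2 * r); have := diam_ge0 (U i).
  case: (diam (U i)) => [d||] //.
  - rewrite poweR_EFin !lee_fin => d0' /(_ r20 (Ur i)) dr.
    by apply: ge0_ler_powR; rewrite ?nnegrE// ltW.
  - by move=> _ /(_ r20 (Ur i)); rewrite leNgt ltry.
rewrite sumEFin lee_fin sumr_const_nat subn0 -(mulr_natl (_ `^ _)).
rewrite powRM ?(ltW r0)// (@powRD _ r); last by rewrite (gt_eqF r0) implybT.
have rs0 : 0 < r `^ s by rewrite powR_gt0.
have /ltW : (size c)%:R * r `^ s < 1.
  by rewrite -ltr_pdivlMr// div1r -powRN.
have : r `^ eta <= eps / 2 `^ (s + eta).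
  have -> : eps / 2 `^ (s + eta) = ((eps / 2 `^ (s + eta)) `^ eta^-1) `^ eta.
    by rewrite -powRrM mulVf ?gt_eqF// powRr1// divr_ge0// ltW.
  apply: ge0_ler_powR; rewrite ?nnegrE ?powR_ge0 ?ltW//.
  by rewrite (lt_le_trans rd)// ge_min lexx orbT.
rewrite ler_pdivlMr// => h1 h2.
rewrite -[leRHS]mul1r.
have -> : (size c)%:R * (2 `^ (s + eta) * (r `^ s * r `^ eta)) =
  ((size c)%:R * r `^ s) * (r `^ eta * 2 `^ (s + eta)) by ring.
by apply: ler_pM => //; rewrite mulr_ge0// ?powR_ge0.
Qed.

End hausdorff_covers.

(** * Upper box dimension from local covers *)

Section box_dimension.
Context {R : realType} {T : metricType R}.
Implicit Types (F : set T) (c : seq T) (u r M sigma : R).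

(** The points of [c] are distinct and at mutual distance larger than [u]. *)
Definition separated u c : Prop :=
  uniq c /\ forall x y, x \in c -> y \in c -> x != y -> u < mdist x y.

(** At most [M] closed balls of radius [u] cover [F]. The centers are required
    to lie in [F], so that the hypotheses on the points of [F] apply to them
    when a cover is refined. *)
Definition covered F u M : Prop :=
  exists c : seq T, [/\ (size c)%:R <= M, forall x, x \in c -> F x &
    forall x, F x -> exists2 y, y \in c & mdist y x <= u].

Lemma coveredW F u u' M M' : u <= u' -> M <= M' ->
  covered F u M -> covered F u' M'.
Proof.
move=> uu MM [c [cM cF Fc]]; exists c; split => //; first exact: le_trans MM.
by move=> x /Fc[y yc yx]; exists y => //; exact: le_trans uu.
Qed.

(** A maximal separated subset of [F] is a net of [F]. *)
Lemma covered_separated F u M : 0 <= u ->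
  (forall c, separated u c -> (forall x, x \in c -> F x) -> (size c)%:R <= M) ->
  covered F u M.
Proof.
move=> u0 H.
have M0 : 0 <= M by apply: (H [::]).
pose P k := `[< exists c,
  [/\ separated u c, forall x, x \in c -> F x & size c = k] >].
have P0 : exists k, P k.
  by exists 0%N; apply/asboolP; exists [::]; split=> //; split.
have Pub k : P k -> (k <= Num.truncn M)%N.
  by move=> /asboolP[c [sc cF <-]]; rewrite truncn_ge_nat ?H.
case: (ex_maxnP P0 Pub) => k /asboolP[c [[uc sc] cF sk]] kmax.
exists c; split => //; first exact: H.
move=> x Fx; apply: contrapT => /forall2NP nx.
have xc y : y \in c -> u < mdist y x.
  by move=> yc; case: (nx y) => // /negP; rewrite -ltNge.
have xnc : x \notin c.
  by apply/negP => /xc; rewrite mdistxx ltNge u0.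
suff /kmax : P k.+1 by rewrite ltnn.
apply/asboolP; exists (x :: c); split; last by rewrite /= sk.
  split; first by rewrite /= xnc.
  move=> y z; rewrite !inE => /orP[/eqP->|yc] /orP[/eqP->|zc] yz.
  - by rewrite eqxx in yz.
  - by rewrite metric_sym xc.
  - exact: xc.
  - exact: sc.
by move=> y; rewrite inE => /orP[/eqP->//|/cF].
Qed.

Lemma covered_local F r u M1 M2 : 0 <= M2 -> covered F r M1 ->
  (forall x, F x -> covered (F `&` [set y | mdist x y <= r]) u M2) ->
  covered F u (M1 * M2).
Proof.
move=> M20 [c [cM cF Fc]] H.
have /choice[g gP] : forall x, exists d : seq T, F x ->
    [/\ (size d)%:R <= M2, forall y, y \in d -> F y &
    forall z, F z -> mdist x z <= r -> exists2 y, y \in d & mdist y z <= u].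
  move=> x; have [Fx|nFx] := pselect (F x); last by exists [::].
  have [d [dM dF Fd]] := H x Fx; exists d => _; split => //.
    by move=> y /dF[].
  by move=> z Fz xz; apply: Fd.
exists (flatten [seq g x | x <- c]); split.
- rewrite size_flatten /shape -map_comp sumnE big_map natr_sum.
  rewrite (@le_trans _ _ (\sum_(x <- c) M2))//.
    rewrite big_seq [leRHS]big_seq; apply: ler_sum => x xc.
    by have [] := gP x (cF x xc).
  by rewrite big_const_seq count_predT iter_addr_0 -(mulr_natl M2) ler_wpM2r.
- move=> y /flattenP[d /mapP[x xc ->] yd].
  by have [_ + _] := gP x (cF x xc); apply.
- move=> z Fz; have [x xc xz] := Fc z Fz.
  have [_ _ /(_ z Fz xz)[y yd yz]] := gP x (cF x xc).
  by exists y => //; apply/flattenP; exists (g x) => //; apply: map_f.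
Qed.

End box_dimension.

Section small_powers.
Context {R : realType}.
Implicit Types (B eta u : R).

Lemma powR_small B eta : 0 < eta -> exists2 u1, 0 < u1 &
  forall u, 0 < u < u1 -> B * u `^ eta <= 1.
Proof.
move=> eta0; have B0 : 0 < `|B| + 1 by rewrite ltr_wpDl.
exists ((`|B| + 1)^-1 `^ eta^-1); first by rewrite powR_gt0 ?invr_gt0.
move=> u /andP[u0 uu].
rewrite (@le_trans _ _ ((`|B| + 1) * u `^ eta))//.
  rewrite ler_wpM2r ?powR_ge0//.
  by rewrite (le_trans (ler_norm _))// lerDl.
rewrite mulrC -ler_pdivlMr// div1r.
have -> : (`|B| + 1)^-1 = ((`|B| + 1)^-1 `^ eta^-1) `^ eta.
  by rewrite -powRrM mulVf ?gt_eqF// powRr1// invr_ge0 ltW.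
by apply: ge0_ler_powR; rewrite ?nnegrE ?powR_ge0 ?ltW.
Qed.

Lemma powRDp u a b : 0 < u -> u `^ (a + b) = u `^ a * u `^ b.
Proof. by move=> u0; rewrite powRD// (gt_eqF u0) implybT. Qed.

End small_powers.

Section box_dimension_bounds.
Context {R : realType} {T : metricType R}.
Implicit Types (F : set T) (sigma : R).

(** If a ball of radius [u ^ kappa] centered in [F] meets [F] in a set covered
    by [C u ^ (- gamma)] balls of radius [u], then passing from the scale
    [u ^ kappa] to the scale [u] repeatedly covers [F] by about [u ^ (- sigma)]
    balls as soon as [kappa sigma + gamma < sigma]. *)
Lemma covered_iteration F (kappa gamma sigma C u0 : R) :
  0 < u0 -> 0 < kappa < 1 -> 0 <= gamma -> gamma < (1 - kappa) * sigma ->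
  0 <= C ->
  (forall u, 0 < u -> exists M, covered F u M) ->
  (forall u x, 0 < u < u0 -> F x ->
    covered (F `&` [set y | mdist x y <= u `^ kappa]) u (C * u `^ (- gamma))) ->
  exists A, forall u, 0 < u <= 1 -> covered F u (A * u `^ (- sigma)).
Proof.
move=> u00 /andP[k0 k1] g0 gs C0 tb loc.
have k10 : 0 < 1 - kappa by rewrite subr_gt0.
have s0 : 0 < sigma by rewrite -(pmulr_rgt0 _ k10) (le_lt_trans g0).
pose eta := (1 - kappa) * sigma - gamma.
have eta0 : 0 < eta by rewrite subr_gt0.
have [v1 v10 hv1] := powR_small C eta0.
have [v2 v20 hv2] := powR_small 2 k10.
pose u1 := Num.min u0 (Num.min v1 v2).
have u10 : 0 < u1 by rewrite !lt_min u00 v10.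
have [M0 hM0] := tb _ u10.
pose A := `|M0|; exists A.
(* Induction on the scale: [u ^ kappa >= 2 u] for small [u]. *)
suff H k u : u1 / 2 ^+ k <= u -> u <= 1 -> covered F u (A * u `^ (- sigma)).
  move=> u /andP[up ule1]; pose k := (Num.truncn (u1 / u)).+1.
  apply: (H k) => //; rewrite ler_pdivrMr ?exprn_gt0// mulrC -ler_pdivrMr//.
  rewrite (@le_trans _ _ (k%:R))//; last first.
    by rewrite -natrX ler_nat ltnW// ltn_expl.
  by rewrite ltW// truncnS_gt.
elim: k u => [|k IH] u.
  rewrite expr0 divr1 => u1u ule1.
  apply: coveredW hM0 => //; rewrite (le_trans (ler_norm _))//.
  rewrite ler_peMr ?normr_ge0//.
  have up : 0 < u := lt_le_trans u10 u1u.
  by rewrite -(powRr0 u) ger_powR ?up// oppr_le0 ltW.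
move=> uk ule1.
have [u1u|uu1] := leP (u1 / 2 ^+ k) u; first exact: IH.
have up : 0 < u by rewrite (lt_le_trans _ uk)// divr_gt0// exprn_gt0.
have : u < u1.
  rewrite (lt_le_trans uu1)// ler_piMr ?(ltW u10)// invf_le1 ?exprn_gt0//.
  by rewrite exprn_ege1// ler1n.
rewrite !lt_min => /and3P[uu0 uv1 uv2].
have h1 : C * u `^ eta <= 1 by rewrite hv1// up.
have h2 : 2 * u <= u `^ kappa.
  have := hv2 u; rewrite up uv2 => /(_ isT) h.
  have {1}-> : u = u `^ kappa * u `^ (1 - kappa).
    by rewrite -powRDp// addrC subrK powRr1// ltW.
  by rewrite mulrCA ler_piMr// powR_ge0.
have ukp : 0 < u `^ kappa by rewrite powR_gt0.
have uk1 : u `^ kappa <= 1 by rewrite -(powRr0 u) ger_powR ?up// ltW.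
have uks : u1 / 2 ^+ k <= u `^ kappa.
  rewrite (le_trans _ h2)//.
  move: uk; rewrite ler_pdivrMr ?exprn_gt0// exprS => uk.
  by rewrite ler_pdivrMr ?exprn_gt0// -mulrA mulrCA.
have := IH _ uks uk1.
have Cu : 0 <= C * u `^ (- gamma) by rewrite mulr_ge0// powR_ge0.
move=> /(covered_local Cu) /(_ (fun x => loc u x _)).
rewrite up uu0 => /(_ isT); apply: coveredW => //.
rewrite -powRrM -mulrA ler_wpM2l ?normr_ge0// mulrCA -powRDp//.
have -> : kappa * - sigma + - gamma = eta + - sigma by rewrite /eta; ring.
by rewrite powRDp// mulrA ler_piMl// powR_ge0.
Qed.

Lemma covering_number_ge0 F (delta : R) : (0 <= covering_number F delta)%E.
Proof. by apply: le_ereal_inf_tmp => _ [k _ <-]; rewrite lee_fin. Qed.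

Lemma covering_number_le F (delta M : R) : covered F delta M ->
  (covering_number F delta <= M%:E)%E.
Proof.
move=> [c [cM _ Fc]]; apply: ge_ereal_inf; exists ((size c)%:R%:E); last first.
  by rewrite lee_fin.
exists (size c) => //=; exists (fun i => tnth (in_tuple c) i) => x /Fc[y yc yx].
have ic : (index y c < size c)%N by rewrite index_mem.
exists (Ordinal ic) => //.
by rewrite /metric_closed_ball/= (tnth_nth y) nth_index.
Qed.

Lemma upper_box_dim_le F (A u0 sigma sigma' : R) :
  0 < u0 -> 0 <= sigma < sigma' ->
  (forall u, 0 < u < u0 -> covered F u (A * u `^ (- sigma))) ->
  (upper_box_dim F <= sigma'%:E)%E.
Proof.
move=> u00 /andP[s0 ss] H; apply: ereal_inf_lbound; exists sigma' => //; split.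
  by rewrite ltW// (le_lt_trans s0).
apply/eqP; rewrite eq_le; apply/andP; split; last first.
  apply: limf_esup_ge0; first exact: filter_not_empty.
  by move=> u; rewrite mule_ge0 ?covering_number_ge0// lee_fin powR_ge0.
apply/lee_addgt0Pr => eps eps0; rewrite add0e.
have ds : 0 < sigma' - sigma by rewrite subr_gt0.
have [u1 u10 hu1] := powR_small (A / eps) ds.
apply: ge_ereal_inf; exists (ereal_sup
  [set (covering_number F u * (u `^ sigma')%:E)%E | u in `]0, (Num.min u0 u1)[]).
  exists `]0, (Num.min u0 u1)[%classic => //.
  have m0 : 0 < Num.min u0 u1 by rewrite lt_min u00.
  by near=> u; rewrite /= in_itv/=; apply/andP; split; near: u;
    [exact: nbhs_right_gt|exact: nbhs_right_lt].
apply: ub_ereal_sup => _ [u /= + <-].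
rewrite in_itv/= lt_min => /and3P[up uu0 uu1].
have := covering_number_le (H u _); rewrite up uu0 => /(_ isT) h.
rewrite (@le_trans _ _ ((A * u `^ (- sigma))%:E * (u `^ sigma')%:E)%E)//.
  by rewrite lee_wpmul2r// lee_fin powR_ge0.
rewrite -EFinM lee_fin -mulrA -powRDp// addrC.
by have := hu1 u; rewrite up uu1 mulrAC => /(_ isT); rewrite ler_pdivrMr// mul1r.
Unshelve. all: by end_near.
Qed.

End box_dimension_bounds.

(** * Projections of Euclidean space along a direction *)

Section euclidean_norm.
Context {R : realType} {n : nat}.
Implicit Types (x y w e f : euclidean R n) (a t : R).

Lemma l2norm_ge0 x : 0 <= l2norm x.
Proof. exact: sqrtr_ge0. Qed.

Lemma l2normZ a x : l2norm (a *: x) = `|a| * l2norm x.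
Proof.
by rewrite /l2norm dotvZl dotvZr mulrA -expr2 sqrtrM ?sqr_ge0// sqrtr_sqr.
Qed.

Lemma l2normB x y : l2norm (x - y) <= l2norm x + l2norm y.
Proof. by rewrite (le_trans (l2normD _ _))// l2normN. Qed.

Lemma l2norm_distC x y : l2norm (x - y) = l2norm (y - x).
Proof. by rewrite -opprB l2normN. Qed.

Lemma l2norm_sqr x : l2norm x ^+ 2 = dotv x x.
Proof. by rewrite sqr_sqrtr// dotvv_ge0. Qed.

Lemma ler_dotv x y : `|dotv x y| <= l2norm x * l2norm y.
Proof.
rewrite -(@ler_pXn2r _ 2)// ?nnegrE ?mulr_ge0 ?l2norm_ge0//.
by rewrite real_normK ?num_real// exprMn !l2norm_sqr cauchy_schwarz.
Qed.

Lemma proj_perpD e x y : proj_perp e (x + y) = proj_perp e x + proj_perp e y.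
Proof. by rewrite /proj_perp dotvDl scalerDl opprD addrACA. Qed.

Lemma proj_perpZ e a x : proj_perp e (a *: x) = a *: proj_perp e x.
Proof. by rewrite /proj_perp dotvZl scalerBr scalerA. Qed.

Lemma proj_perpN e x : proj_perp e (- x) = - proj_perp e x.
Proof. by rewrite -scaleN1r proj_perpZ scaleN1r. Qed.

Lemma proj_perpB e x y : proj_perp e (x - y) = proj_perp e x - proj_perp e y.
Proof. by rewrite proj_perpD proj_perpN. Qed.

(** The seminorm [l2norm (proj_perp e x)] of a vector, i.e. its distance to the
    line spanned by the unit vector [e]. *)
Definition perp_norm e x : R := l2norm (proj_perp e x).

Lemma perp_norm_ge0 e x : 0 <= perp_norm e x.
Proof. exact: l2norm_ge0. Qed.

Lemma perp_normD e x y : perp_norm e (x + y) <= perp_norm e x + perp_norm e y.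
Proof. by rewrite /perp_norm proj_perpD l2normD. Qed.

Lemma perp_norm_distC e x y : perp_norm e (x - y) = perp_norm e (y - x).
Proof. by rewrite /perp_norm !proj_perpB l2norm_distC. Qed.

Lemma perp_normZ e a x : perp_norm e (a *: x) = `|a| * perp_norm e x.
Proof. by rewrite /perp_norm proj_perpZ l2normZ. Qed.

Lemma perp_norm0 e : perp_norm e 0 = 0.
Proof. by rewrite -(scale0r 0) perp_normZ normr0 mul0r. Qed.

Lemma perp_norm_triangle e y x z :
  perp_norm e (x - z) <= perp_norm e (x - y) + perp_norm e (y - z).
Proof. by rewrite (le_trans _ (perp_normD _ _ _))// addrA subrK. Qed.

Lemma perp_norm_moved e x x' y y' (l d : R) :
  perp_norm e (x - x') <= d -> perp_norm e (y' - y) <= d ->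
  l < perp_norm e (x - y) -> l - 2 * d <= perp_norm e (x' - y').
Proof.
move=> h1 h2 h3; rewrite lerBlDr mulr_natl mulr2n addrCA.
apply: le_trans (ltW h3) (le_trans (perp_norm_triangle e x' x y) (lerD h1 _)).
exact: le_trans (perp_norm_triangle e y' x' y) (lerD (lexx _) h2).
Qed.

Lemma sphere_dotvv e : sphere R n e -> dotv e e = 1.
Proof. by move=> e1; rewrite -l2norm_sqr e1 expr1n. Qed.

Lemma perp_norm_le e x : sphere R n e -> perp_norm e x <= l2norm x.
Proof.
move=> e1; rewrite -(@ler_pXn2r _ 2)// ?nnegrE ?l2norm_ge0// !l2norm_sqr.
rewrite /proj_perp -scaleNr !(dotvDl, dotvDr, dotvZl, dotvZr) (sphere_dotvv e1).
rewrite (dotvC e x) -subr_ge0 (_ : _ - _ = dotv x e ^+ 2) ?sqr_ge0//.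
by ring.
Qed.

(** The seminorm depends on the direction in a Lipschitz way. *)
Lemma perp_norm_dir e f x : sphere R n e -> sphere R n f ->
  perp_norm e x <= perp_norm f x + 2 * l2norm x * l2norm (e - f).
Proof.
move=> e1 f1.
have E : proj_perp e x =
    proj_perp f x + (dotv x (f - e) *: e + dotv x f *: (f - e)).
  have -> : dotv x (f - e) = dotv x f - dotv x e.
    by rewrite dotvDr -scaleN1r dotvZr mulN1r.
  rewrite /proj_perp.
  by apply/rowP => i; rewrite !mxE; ring.
rewrite {1}/perp_norm E (le_trans (l2normD _ _))// lerD2l.
rewrite (le_trans (l2normD _ _))// !l2normZ e1 mulr1 l2norm_distC.
have := ler_dotv x (f - e); have := ler_dotv x f; rewrite f1 mulr1.
rewrite (l2norm_distC f e).
move: (l2norm_ge0 (e - f)) (l2norm_ge0 x) => h1 h2 h3 h4.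
suff : `|dotv x f| * l2norm (e - f) <= l2norm x * l2norm (e - f) by lra.
exact: ler_wpM2r.
Qed.

(** Two directions at distance at most [1] that are nearly parallel to the same
    long vector are very close. Without the bound on their distance they could
    also be nearly antipodal. *)
Lemma sphere_close e f w t : sphere R n e -> sphere R n f ->
  l2norm (e - f) <= 1 -> perp_norm e w <= t -> perp_norm f w <= t ->
  8 * t < l2norm w -> l2norm w * l2norm (e - f) <= 8 * t.
Proof.
move=> e1 f1 ef et ft tw.
have t0 : 0 <= t := le_trans (perp_norm_ge0 _ _) et.
pose a := dotv w e; pose b := dotv w f.
have we : w = a *: e + proj_perp e w by rewrite /proj_perp addrC subrK.
have wf : w = b *: f + proj_perp f w by rewrite /proj_perp addrC subrK.
have wa : l2norm w <= `|a| + t.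
  rewrite {1}we (le_trans (l2normD _ _))// l2normZ e1 mulr1 lerD2l//.
have ab : l2norm (a *: e - b *: f) <= 2 * t.
  have -> : a *: e - b *: f = proj_perp f w - proj_perp e w.
    by rewrite /proj_perp -/a -/b opprB [RHS]addrC [_ + (w - _)]addrA subrK.
  by rewrite (le_trans (l2normB _ _))// mulr2n mulrDl mul1r lerD.
have abn : `| (`|a| - `|b|) | <= 2 * t.
  rewrite ler_norml lerBlDr lerNl opprB lerBlDr; apply/andP; split.
    have := l2normB (a *: e) (a *: e - b *: f).
    rewrite opprB addrC subrK !l2normZ e1 f1 !mulr1; lra.
  have := l2normD (a *: e - b *: f) (b *: f).
  rewrite subrK !l2normZ e1 f1 !mulr1; lra.
(* Whether [w] points to the same side along [e] and along [f]. *)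
have [ab0|ab0] := leP 0 (a * b).
  have {}abn : `|b - a| <= 2 * t.
    move: abn; have [a0|a0] := ger0P a; have [b0|b0] := ger0P b.
    - by rewrite distrC.
    - have -> : a = 0 by apply/eqP; nra.
      by rewrite subr0 sub0r opprK.
    - have -> : b = 0 by apply/eqP; nra.
      by rewrite subr0 sub0r.
    - by rewrite opprK addrC.
  have : `|a| * l2norm (e - f) <= 4 * t.
    rewrite -l2normZ.
    have -> : a *: (e - f) = (a *: e - b *: f) + (b - a) *: f.
      by apply/rowP => i; rewrite !mxE; ring.
    rewrite (le_trans (l2normD _ _))// l2normZ f1 mulr1; lra.
  have := l2norm_ge0 (e - f); nra.
exfalso.
have {}abn : `|b + a| <= 2 * t.
  move: abn; have [a0|a0] := ger0P a; have [b0|b0] := ger0P b.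
  - by move: ab0; rewrite ltNge mulr_ge0.
  - by rewrite opprK addrC.
  - by rewrite -opprD normrN addrC.
  - by move: ab0; rewrite ltNge; nra.
have h : `|a| * l2norm (e + f) <= 4 * t.
  rewrite -l2normZ.
  have -> : a *: (e + f) = (a *: e - b *: f) + (b + a) *: f.
    by apply/rowP => i; rewrite !mxE; ring.
  rewrite (le_trans (l2normD _ _))// l2normZ f1 mulr1; lra.
have : 1 <= l2norm (e + f).
  have := l2normD (e + f) (e - f).
  have -> : (e + f) + (e - f) = 2 *: e by apply/rowP => i; rewrite !mxE; ring.
  rewrite l2normZ e1 normr_nat; lra.
nra.
Qed.

Lemma sphere_coord_le e (i : 'I_n) : sphere R n e ->
  `|(e : 'rV[R]_n) 0 i| <= 1.
Proof.
move=> e1; rewrite -(@ler_pXn2r _ 2)// ?nnegrE// expr1n real_normK ?num_real//.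
rewrite -(sphere_dotvv e1) /dotv (bigD1 i)//= -expr2 lerDl.
by apply: sumr_ge0 => j _; rewrite -expr2 sqr_ge0.
Qed.

Lemma l2norm_le_coord (h : R) x : 0 <= h ->
  (forall i, `|(x : 'rV[R]_n) 0 i| <= h) -> l2norm x <= n.+1%:R * h.
Proof.
move=> h0 xh; rewrite -(@ler_pXn2r _ 2)// ?nnegrE ?l2norm_ge0 ?mulr_ge0//.
rewrite l2norm_sqr (@le_trans _ _ (\sum_(i < n) h ^+ 2))//.
  apply: ler_sum => i _; rewrite -expr2 -real_normK ?num_real//.
  by rewrite ler_pXn2r// nnegrE.
rewrite sumr_const card_ord -(mulr_natl (h ^+ 2)) exprMn ler_wpM2r ?sqr_ge0//.
by rewrite -natrX ler_nat (leq_trans (leqnSn n))// -[leqLHS]expn1 leq_pexp2l.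
Qed.

(** Separated points lie in distinct cells of a grid of mesh [u / (n + 1)]. *)
Lemma sphere_totally_bounded (F : set (sphere R n)) (u : R) : 0 < u ->
  exists M, covered F u M.
Proof.
move=> u0; have [h h0 uE] : exists2 h : R, 0 < h & u = n.+1%:R * h.
  by exists (u / n.+1%:R); rewrite ?divr_gt0// mulrCA mulfV ?mulr1.
pose m := Num.truncn (2 / h).
pose g (x : sphere R n) : {ffun 'I_n -> 'I_m.+1} :=
  [ffun i => inord (Num.truncn (((set_val x : 'rV[R]_n) 0 i + 1) / h))].
exists (#|{ffun 'I_n -> 'I_m.+1}|%:R); apply: covered_separated (ltW u0) _.
move=> c [uc sc] _; rewrite ler_nat.
have gi : {in c &, injective g}.
  move=> x y xc yc gxy; apply/eqP/negPn/negP => /(sc _ _ xc yc).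
  rewrite ltNge => /negP; apply.
  rewrite uE; apply: l2norm_le_coord (ltW h0) _ => i.
  move/ffunP/(_ i): gxy; rewrite !ffunE => /(congr1 val)/=.
  have bnd (z : sphere R n) :
      0 <= (((set_val z : 'rV[R]_n) 0 i + 1) / h) <= 2 / h.
    have := sphere_coord_le i (set_valP z); rewrite ler_norml => /andP[h1 h2].
    apply/andP; split; first by rewrite divr_ge0 ?(ltW h0)//; lra.
    by rewrite ler_pM2r ?invr_gt0//; lra.
  have tb (z : sphere R n) :
      (Num.truncn (((set_val z : 'rV[R]_n) 0 i + 1) / h)%R < m.+1)%N.
    by rewrite ltnS le_truncn//; case/andP: (bnd z).
  rewrite !inordK// => E.
  have /andP[x0 _] := bnd x; have /andP[y0 _] := bnd y.
  have := truncn_itv x0; have := truncn_itv y0; rewrite E.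
  move: (Num.truncn _) => k /andP[k1 k2] /andP[k3 k4].
  rewrite !mxE.
  move: k1 k2 k3 k4; rewrite !(ler_pdivlMr, ltr_pdivrMr)// -natr1 mulrDl mul1r.
  move: (_ 0 i) (_ 0 i) (k%:R * h) => a b q k1 k2 k3 k4.
  by rewrite ler_norml; apply/andP; split; lra.
by rewrite -(size_map g) -(card_uniqP _) ?max_card// map_inj_in_uniq.
Qed.

End euclidean_norm.

(** * Pieces of a self-similar set and the dimension of its projections *)

Section finite_sequences.
Context {T : eqType}.
Implicit Types (s : seq T) (P : pred T) (r : rel T).

Lemma count_le1 P s : uniq s ->
  (forall x y, x \in s -> y \in s -> P x -> P y -> x = y) -> (count P s <= 1)%N.
Proof.
move=> us H; rewrite -size_filter.
have := filter_uniq P us.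
have : forall x, x \in [seq z <- s | P z] -> P x && (x \in s).
  by move=> x; rewrite mem_filter.
case: [seq z <- s | P z] => [//|x [//|y l]] Pl /=.
rewrite inE => /andP[/norP[/negP xy _] _]; case: xy; apply/eqP.
have /andP[Px xs] := Pl x (mem_head _ _).
have /andP[Py ys] : P y && (y \in s) by apply: Pl; rewrite !inE eqxx orbT.
exact: H.
Qed.

(** A maximal subset of pairwise unrelated elements of [s]. *)
Lemma maximal_unrelated r s : reflexive r -> symmetric r ->
  exists s', [/\ uniq s', {subset s' <= s},
    forall x y, x \in s' -> y \in s' -> x != y -> ~~ r x y &
    forall x, x \in s -> exists2 y, y \in s' & r x y].
Proof.
move=> rr rs; elim: s => [|x s [s' [us ss ns cs]]]; first by exists [::].
have [/hasP[y ys xy]|/hasPn nx] := boolP (has (r x) s').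
  exists s'; split => //.
    by move=> z /ss zs; rewrite inE zs orbT.
  by move=> z; rewrite inE => /orP[/eqP->|/cs//]; exists y.
exists (x :: s'); split.
- rewrite /= us andbT; apply/negP => /nx; by rewrite rr.
- by move=> z; rewrite !inE => /orP[->//|/ss->]; rewrite orbT.
- move=> y z; rewrite !inE => /orP[/eqP->|ys] /orP[/eqP->|zs].
  + by rewrite eqxx.
  + by move=> _; exact: nx.
  + by move=> _; rewrite rs; exact: nx.
  + exact: ns.
- move=> y; rewrite inE => /orP[/eqP->|/cs[z zs yz]].
    by exists x; rewrite // mem_head.
  by exists z => //; rewrite inE zs orbT.
Qed.

End finite_sequences.

Section pieces.
Context {R : realType} {n : nat}.
Local Notation E := (euclidean R n).
Implicit Types (K : set E) (e x y : E) (p : R * E) (U W : seq (R * E)).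

(** A pair [(a, b)] stands for the homothety [x |-> a *: x + b]. *)
Definition pact p x : E := homothety p.1 p.2 x.

(** The pair encoding the composition of two homotheties. *)
Definition pair_comp p p' : R * E := (p.1 * p'.1, p.1 *: p'.2 + p.2).

Lemma pact_comp p p' x : pact (pair_comp p p') x = pact p (pact p' x).
Proof.
by rewrite /pact /homothety/= scalerDr scalerA addrA.
Qed.

Lemma pactB p x y : pact p x - pact p y = p.1 *: (x - y).
Proof. by rewrite /pact /homothety opprD addrACA subrr addr0 scalerBr. Qed.

(** The homothety [p] maps [K] into itself: [pact p @` K] is then a piece of
    [K]. *)
Definition preserves K p : Prop := forall x, K x -> K (pact p x).

(** If the pieces [U] of [K] have ratio at least [lam], are at mutual distance at
    least [q] as seen in the direction [e], and are at least [lam ^ (- t)] in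
    number, then no finite cover of [K] has a smaller sum of [t]-th powers of
    widths than a single set of width [q]. The width of a set is its diameter
    for [perp_norm e]. Either some set of the cover has width at least [q], or
    each set meets at most one piece; then the sets meeting a given piece are
    fewer than all the sets, and blowing the piece up to [K] allows an induction
    on the number of sets. *)
Lemma finite_cover_lower_bound K e (lam q t : R) U :
  0 < lam -> 0 < q -> 0 < t -> K !=set0 ->
  uniq U -> (2 <= size U)%N ->
  (forall p, p \in U -> lam <= p.1) -> (forall p, p \in U -> preserves K p) ->
  (forall p p', p \in U -> p' \in U -> p != p' -> forall x y, K x -> K y ->
    q <= perp_norm e (pact p x - pact p' y)) ->
  1 <= (size U)%:R * lam `^ t ->
  forall (s : seq nat) (A : nat -> set E) (rho : nat -> R),
    (forall i, 0 < rho i) ->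
    (forall i x y, A i x -> A i y -> perp_norm e (x - y) < rho i) ->
    (forall x, K x -> exists2 i, i \in s & A i x) ->
    q `^ t <= \sum_(i <- s) rho i `^ t.
Proof.
move=> lam0 q0 t0 [x0 Kx0] uU U2 Ulam UK Usep Ut s.
have [m] := ubnP (size s); elim: m s => // m IH s sm A rho rho0 Arho cov.
have [/hasP[i si qi]|/hasPn small] := boolP (has (fun i => q <= rho i) s).
  rewrite (big_rem i)//= -[leLHS]addr0 lerD//.
    by apply: ge0_ler_powR; rewrite ?nnegrE// ltW.
  by apply: sumr_ge0 => j _; exact: powR_ge0.
pose P p i := `[< exists2 x, K x & A i (pact p x) >].
have P1 i p p' : i \in s -> p \in U -> p' \in U -> P p i -> P p' i -> p = p'.
  move=> si pU pU' /asboolP[x Kx Ax] /asboolP[y Ky Ay].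
  apply/eqP/negPn/negP => /(Usep _ _ pU pU') /(_ x y Kx Ky).
  by apply/negP; rewrite -ltNge (lt_trans (Arho _ _ _ Ax Ay))// ltNge small.
(* The part of the cover that meets the piece [p], blown up by [1 / p.1]. *)
have step p : p \in U -> q `^ t * lam `^ t <= \sum_(i <- s | P p i) rho i `^ t.
  move=> pU; have p0 : 0 < p.1 := lt_le_trans lam0 (Ulam p pU).
  have [p' pU' pp'] : exists2 p', p' \in U & p' != p.
    apply: contrapT => /forall2NP H.
    have : (count predT U <= 1)%N.
      apply: count_le1 => // x y xU yU _ _.
      have eqp z : z \in U -> z = p.
        by move=> zU; case: (H z) => // /negP; rewrite negbK => /eqP.
      by rewrite (eqp x)// (eqp y).
    by rewrite count_predT leqNgt U2.
  have [j js Aj] := cov _ (UK _ pU' _ Kx0).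
  have Pj : ~~ P p j.
    apply/negP => Ppj; have := P1 j p p' js pU pU' Ppj.
    move=> E; move/eqP: pp'; apply; rewrite E//.
    by apply/asboolP; exists x0.
  have size_lt : (size [seq i <- s | P p i] < m)%N.
    rewrite -ltnS (leq_trans _ sm)// ltnS size_filter -(count_predC (P p)).
    by rewrite -[X in (X < _)%N]addn0 ltn_add2l -has_count; apply/hasP; exists j.
  have := IH _ size_lt (fun i => [set x | A i (pact p x)])
    (fun i => rho i / p.1).
  move=> /(_ _ _ _)/wrap[].
  - by move=> i; rewrite divr_gt0.
  - move=> i x y /= Ax Ay; rewrite ltr_pdivlMr//.
    have := Arho i _ _ Ax Ay; rewrite pactB perp_normZ gtr0_norm//.
    by rewrite mulrC.
  - move=> x Kx; have [i si Ai] := cov _ (UK _ pU _ Kx).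
    exists i => //; rewrite mem_filter si andbT.
    by apply/asboolP; exists x.
  move=> h; rewrite -big_filter.
  have E i : (rho i / p.1) `^ t = rho i `^ t / p.1 `^ t.
    by rewrite powRM ?invr_ge0 ?ltW// -powR_inv1 ?ltW// -powRrM mulN1r powRN.
  move: h => /=; under eq_bigr do rewrite E.
  rewrite -mulr_suml ler_pdivlMr ?powR_gt0// => /(le_trans _); apply.
  rewrite ler_wpM2l ?powR_ge0//.
  by apply: ge0_ler_powR; rewrite ?nnegrE ?Ulam// ltW.
rewrite (@le_trans _ _ (\sum_(p <- U) \sum_(i <- s | P p i) rho i `^ t))//.
  rewrite (@le_trans _ _ (\sum_(p <- U) q `^ t * lam `^ t))//; last first.
    rewrite big_seq [leRHS]big_seq; exact: ler_sum.
  rewrite big_const_seq count_predT iter_addr_0 -(mulr_natl (_ * _)) mulrCA.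
  by rewrite ler_peMr// powR_ge0.
under eq_bigr do rewrite big_mkcond.
rewrite exchange_big/= big_seq [leRHS]big_seq; apply: ler_sum => i si.
rewrite -big_mkcond big_const_seq iter_addr_0/=.
have : (count (P^~ i) U <= 1)%N.
  by apply: count_le1 => // x y xU yU; exact: (P1 i).
by case: count => [|[|]]// _; rewrite ?mulr0n ?mulr1n ?powR_ge0.
Qed.

End pieces.

Section compactness.
Context {R : realType} {n : nat}.
Local Notation E := (euclidean R n).
Implicit Types (K : set E) (e x y : E) (p : R * E) (U W : seq (R * E)).

(** A property of points and small positive numbers that holds locally around
    each point of a compact set holds with one number for all its points. *)
Lemma compact_uniform K (P : R -> E -> Prop) : compact K ->
  (forall x, K x -> exists2 r, 0 < r &
    forall y, l2norm (x - y) < r -> forall d, 0 < d < r -> P d y) ->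
  exists2 d, 0 < d & forall x, K x -> P d x.
Proof.
move=> /compact_near_coveringP cK H.
have : \forall d \near (0 : R)^'+, K `<=` P d.
  apply: cK => x /H[r r0 Hr].
  exists (ball x r, `]0, r[%classic) => /=.
    split; first exact: nbhsx_ballx.
    by near=> d; rewrite /= in_itv/=; apply/andP; split; near: d;
      [exact: nbhs_right_gt|exact: nbhs_right_lt].
  by move=> [y d] /= [+ +]; rewrite ballEmdist/= in_itv => xy dr; exact: Hr.
move=> H'; near (0 : R)^'+ => d; exists d; last by near: d.
by near: d; exact: nbhs_right_gt.
Unshelve. all: by end_near.
Qed.

Lemma compact_l2norm_bounded K : compact K ->
  exists2 D, 1 <= D & forall x y, K x -> K y -> l2norm (x - y) <= D.
Proof.
move=> cK.
have [|d d0 H] := @compact_uniform K (fun d x => l2norm x <= d^-1) cK.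
  move=> x _; have x1 : 0 < l2norm x + 1 by rewrite ltr_wpDl ?l2norm_ge0.
  exists (Num.min 1 (l2norm x + 1)^-1); first by rewrite lt_min ltr01 invr_gt0.
  move=> y; rewrite lt_min => /andP[xy _] d; rewrite lt_min => /and3P[d0 _ dx].
  rewrite (@le_trans _ _ (l2norm x + 1))//.
    have := l2normB x (x - y); rewrite opprB addrC subrK; lra.
  by rewrite -[leLHS]invrK lef_pV2 ?posrE ?invr_gt0// ltW.
exists (Num.max 1 (d^-1 + d^-1)); first by rewrite le_max lexx.
move=> x y Kx Ky; rewrite (le_trans (l2normB _ _))// le_max; apply/orP; right.
by rewrite lerD// H.
Qed.

Lemma compact_image_separated K p p' :
  compact K -> 0 < p.1 <= 1 -> 0 < p'.1 <= 1 ->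
  (forall x y, K x -> K y -> pact p x <> pact p' y) ->
  exists2 d, 0 < d &
    forall x y, K x -> K y -> d <= l2norm (pact p x - pact p' y).
Proof.
move=> cK /andP[p0 p1] /andP[p0' p1'] disj.
have lip q x y : 0 < q.1 -> q.1 <= 1 ->
    l2norm (pact q x - pact q y) <= l2norm (x - y).
  by move=> q0 q1; rewrite pactB l2normZ gtr0_norm// ler_piMl ?l2norm_ge0.
(* Compactness is used twice: in [y] for each fixed [x], and then in [x]. *)
have pt x : K x -> exists2 d, 0 < d &
    forall y, K y -> d <= l2norm (pact p x - pact p' y).
  move=> Kx.
  apply: (@compact_uniform K
    (fun d y => d <= l2norm (pact p x - pact p' y))) => // y Ky.
  pose r := l2norm (pact p x - pact p' y).
  have r0 : 0 < r.
    rewrite lt_neqAle l2norm_ge0 andbT eq_sym; apply/eqP => E0.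
    by apply: (disj x y Kx Ky); exact: (@mdist_positivity _ E).
  exists (r / 2); rewrite ?divr_gt0// => z yz d /andP[_ dr].
  have := lip p' z y p0' p1'.
  have := l2normD (pact p x - pact p' z) (pact p' z - pact p' y).
  by rewrite addrA subrK -/r (l2norm_distC z y); lra.
have [|d d0 H] := @compact_uniform K
  (fun d x => forall y, K y -> d <= l2norm (pact p x - pact p' y)) cK.
  move=> x /pt[r r0 Hr]; exists (r / 2); rewrite ?divr_gt0//.
  move=> y xy d /andP[_ dr] z Kz.
  have := lip p x y p0 p1.
  have := l2normD (pact p x - pact p y) (pact p y - pact p' z).
  by rewrite addrA subrK; have := Hr z Kz; lra.
by exists d => // x y Kx Ky; exact: H.
Qed.

(** Many separated pieces of [K] of ratio at least [lam] would force the
    projection to have Hausdorff dimension larger than [s]. The bound does not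
    depend on [q], on [e] or on the pieces. *)
Lemma separated_pieces_card K e (lam q s : R) U :
  compact K -> K !=set0 -> sphere R n e ->
  0 < lam < 1 -> 0 < q -> 0 <= s ->
  (hausdorff_dim (proj_perp e @` K) <= s%:E)%E -> uniq U ->
  (forall p, p \in U -> lam <= p.1) -> (forall p, p \in U -> preserves K p) ->
  (forall p p', p \in U -> p' \in U -> p != p' -> forall x y, K x -> K y ->
    q <= perp_norm e (pact p x - pact p' y)) ->
  (size U)%:R <= lam `^ (- s).
Proof.
move=> cK K0 e1 /andP[lam0 lam1] q0 s0 dimK uU Ulam UK Usep.
rewrite powRN -[leRHS]div1r ler_pdivlMr ?powR_gt0// leNgt; apply/negP.
set X := (_ * _) => X1.
have lams1 : lam `^ s <= 1 by rewrite -(powRr0 lam) ger_powR// lam0 ltW.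
have U2 : (2 <= size U)%N.
  rewrite -(ltr_nat R) (lt_le_trans X1)// /X ler_piMr//.
have lnlam : ln lam < 0 by rewrite ln_lt0// lam0.
(* The exponent [s + eta] is the one for which the number of pieces is
   exactly [lam ^ (- (s + eta))]. *)
pose eta := ln X / - ln lam.
have eta0 : 0 < eta by rewrite divr_gt0 ?ln_gt0 ?oppr_gt0.
have X0 : 0 < X := lt_trans ltr01 X1.
have lameta : lam `^ eta = X^-1.
  rewrite /powR gt_eqF// /eta invrN mulrN mulNr divfK ?lt_eqF//.
  by rewrite expRN lnK.
have Ut : 1 <= (size U)%:R * lam `^ (s + eta).
  by rewrite powRDp// mulrA -/X lameta mulfV// gt_eqF.
have t0 : 0 < s + eta by rewrite ltr_wpDl.
have st : s < s + eta by rewrite ltrDl.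
(* The factor [3] pays for the enlargement of a set of size [rho i] to its open
   [rho i]-neighborhood [B i]. *)
pose eps := q `^ (s + eta) / 3 `^ (s + eta) / 2.
have c3 : 0 < 3 `^ (s + eta) :> R by rewrite powR_gt0.
have qt : 0 < q `^ (s + eta) by rewrite powR_gt0.
have eps0 : 0 < eps by rewrite !divr_gt0.
have [A [rho [KA rho0 Arho Aeps]]] := hausdorff_dim_le_cover dimK st eps0.
pose B i : set E :=
  [set x | exists2 y, A i y & mdist (proj_perp e x) y < rho i].
have [k _ Kk] : \forall k \near \oo,
    K `<=` [set x | exists2 i, (i < k)%N & B i x].
  move/compact_near_coveringP: cK; apply => x Kx.
  have [i _ Ai] := KA _ (imageP (proj_perp e) Kx).
  exists (ball x (rho i), [set k | (i < k)%N]) => /=.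
    by split; [exact: nbhsx_ballx|exists i.+1].
  move=> [y k] /= []; rewrite ballEmdist/= => xy ik.
  exists i => //; exists (proj_perp e x) => //.
  apply: le_lt_trans xy; rewrite /mdist/= -proj_perpB -/(perp_norm e _).
  by rewrite (le_trans (perp_norm_le _ e1))// l2norm_distC.
have := @finite_cover_lower_bound R n K e lam q (s + eta) U lam0 q0 t0 K0 uU U2
  Ulam UK Usep Ut (index_iota 0 k) B (fun i => 3 * rho i).
move=> /(_ _ _ _)/wrap[].
- by move=> i /=; rewrite mulr_gt0.
- move=> i x y /= [x' Ax xx'] [y' Ay yy'].
  have := Arho i _ _ Ax Ay.
  have := metric_triangle (proj_perp e x) x' (proj_perp e y).
  have := metric_triangle x' y' (proj_perp e y).
  move: xx' yy'; rewrite (metric_sym (proj_perp e y) y') /perp_norm proj_perpB.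
  have -> : l2norm (proj_perp e x - proj_perp e y) =
    mdist (proj_perp e x) (proj_perp e y) by [].
  by lra.
- move=> x Kx; have [i ik Bi] := Kk k (leqnn k) x Kx.
  by exists i => //; rewrite mem_index_iota.
rewrite /=; under eq_bigr do rewrite powRM// ?ltW//.
rewrite -mulr_sumr mulrC -ler_pdivrMr// => /le_trans/(_ (Aeps k)).
have : 0 < q `^ (s + eta) / 3 `^ (s + eta) by rewrite divr_gt0.
rewrite /eps; lra.
Qed.

End compactness.

(** * Pieces of a prescribed size *)

Lemma finite_lower_bound (R : realType) (I : finType) (f : I -> R) :
  (forall i, 0 < f i) -> exists2 c, 0 < c < 1 & forall i, c <= f i.
Proof.
move=> f0; exists (\big[Num.min/2^-1]_i f i); last by move=> i; exact: bigmin_le.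
apply/andP; split; first by apply/bigmin_gtP; split => //; rewrite invr_gt0.
rewrite (@le_lt_trans _ _ 2^-1)//; first exact: bigmin_le_id.
by rewrite invf_lt1// ltr1n.
Qed.

Section piece_families.
Context {R : realType} {n : nat}.
Local Notation E := (euclidean R n).
Implicit Types (K : set E) (e x y : E) (p : R * E) (U W : seq (R * E)).

(** Finitely many homothetic copies of [K] inside [K], with ratios comparable to
    [q]. *)
Definition piece_family K (lam q : R) W : Prop :=
  [/\ uniq W, forall p, p \in W -> lam * q <= p.1 <= q &
    forall p, p \in W -> preserves K p].

(** The pieces [W] of size [q] cover [K] and are at mutual distance at least
    [d0 q]. *)
Definition cut_out K (lam d0 q : R) W : Prop :=
  [/\ piece_family K lam q W,
    forall x, K x -> exists2 p, p \in W & exists2 y, K y & x = pact p y &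
    forall p p', p \in W -> p' \in W -> p != p' -> forall x y, K x -> K y ->
      d0 * q <= l2norm (pact p x - pact p' y)].

(** At each scale [q] the words of the system at which the contraction ratio
    first drops to [q] or below cut [K] into separated pieces. The recursion
    replaces [q] by [q / a i] for the words that start with [i]; hence the scales
    slightly larger than [1] that appear in the proof. *)
Lemma ifs_cut_out (N : nat) (a : 'I_N -> R) (b : 'I_N -> E) K :
  (forall i, 0 < a i < 1) ->
  is_limit_set (fun i => homothety (a i) (b i)) K ->
  strong_separation (fun i => homothety (a i) (b i)) K ->
  exists lam d0, [/\ 0 < lam < 1, 0 < d0 &
    forall q, 0 < q <= 1 -> exists W, cut_out K lam d0 q W].
Proof.
move=> ha [K0 cK KE] ssc.
have a0 i : 0 < a i by case/andP: (ha i).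
have a1 i : a i < 1 by case/andP: (ha i).
have gK i : preserves K (a i, b i).
  by move=> x Kx; rewrite KE; exists i => //; exists x.
have [lam /andP[lam0 lam1] alam] := finite_lower_bound a0.
have [mu' /andP[mu0 mu1] amu'] : exists2 c, 0 < c < 1 & forall i, c <= 1 - a i.
  by apply: finite_lower_bound => i; rewrite subr_gt0.
pose mu := 1 - mu'.
have [d0 /andP[d00 d01] hd0] : exists2 d, 0 < d < 1 &
    forall ij : 'I_N * 'I_N, ij.1 != ij.2 -> forall x y, K x -> K y ->
      d <= l2norm (pact (a ij.1, b ij.1) x - pact (a ij.2, b ij.2) y).
  have /choice[f fP] : forall ij : 'I_N * 'I_N, exists d, 0 < d /\
    (ij.1 != ij.2 -> forall x y, K x -> K y ->
      d <= l2norm (pact (a ij.1, b ij.1) x - pact (a ij.2, b ij.2) y)).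
    move=> [i j] /=; have [->|ij] := eqVneq i j; first by exists 1.
    have disj x y : K x -> K y -> pact (a i, b i) x <> pact (a j, b j) y.
      move=> Kx Ky xy; have := ssc i j ij.
      rewrite -subset0 => /(_ (pact (a i, b i) x)).
      by apply; split; [exists x|exists y].
    have c01 l : 0 < (a l, b l).1 <= 1 by rewrite /= a0 ltW.
    have [d d0 hd] := compact_image_separated cK (c01 i) (c01 j) disj.
    by exists d.
  have [|c c01 cf] := @finite_lower_bound R _ f; first by move=> i; case: (fP i).
  exists c => // ij ne x y Kx Ky; apply: le_trans (cf ij) _.
  by have [_] := fP ij; apply.
exists lam, d0; split; rewrite ?lam0// => q /andP[q0 q1].
have mu01 : 0 < mu < 1 by rewrite /mu; lra.
have [k kq] : exists k, mu ^+ k <= q.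
  have [k _ Hk] : \forall k \near \oo, mu ^+ k < q.
    have /cvg_expr/cvgr_lt : `|mu| < 1 by rewrite gtr0_norm; case/andP: mu01.
    exact.
  by exists k; rewrite ltW// Hk/=.
have large r : 1 <= r -> r <= lam^-1 -> exists W, cut_out K lam d0 r W.
  move=> r1 rlam; exists [:: (1, 0)]; split.
  - split => // p; rewrite inE => /eqP->.
      by rewrite /= r1 andbT mulrC -ler_pdivlMr// div1r.
    by move=> x; rewrite /pact /homothety scale1r addr0.
  - move=> x Kx; exists (1, 0); first by rewrite mem_head.
    by exists x; rewrite // /pact /homothety scale1r addr0.
  - by move=> p p'; rewrite !inE => /eqP-> /eqP->; rewrite eqxx.
have : q <= lam^-1 by rewrite (le_trans q1)// ltW// invf_gt1.
move: q q0 {q1} kq; elim: k => [|k IH] q q0 kq qlam; first exact: large.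
have [q1|q1] := leP 1 q; first exact: large.
have /choice[W HW] : forall i : 'I_N, exists W, cut_out K lam d0 (q / a i) W.
  move=> i; apply: IH; first by rewrite divr_gt0.
    rewrite ler_pdivlMr// (le_trans _ kq)// exprSr.
    rewrite ler_wpM2l ?exprn_ge0//; first by case/andP: mu01 => /ltW.
    by rewrite /mu; have := amu' i; lra.
  rewrite ler_pdivrMr// (le_trans (ltW q1))// ler_pdivlMl// mulr1; exact: alam.
pose V := undup (flatten
  [seq [seq pair_comp (a i, b i) p | p <- W i] | i <- enum 'I_N]).
have VP p : p \in V ->
    exists i, exists2 p', p' \in W i & p = pair_comp (a i, b i) p'.
  rewrite mem_undup => /flattenP[s /mapP[i _ ->] /mapP[p' p'W ->]].
  by exists i, p'.
exists V; split.
- split; first exact: undup_uniq.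
    move=> _ /VP[i [p pW ->]] /=; have [[_ + _] _ _] := HW i => /(_ p pW).
    by rewrite mulrA ler_pdivrMr// ler_pdivlMr// (mulrC (a i)).
  move=> _ /VP[i [p pW ->]] x Kx; rewrite pact_comp; apply: gK.
  by have [[_ _ +] _ _] := HW i; apply.
- move=> x; rewrite {1}KE => -[i _ [y Ky <-]].
  have [_ + _] := HW i => /(_ y Ky)[p pW [z Kz ->]].
  exists (pair_comp (a i, b i) p); last by exists z => //; rewrite pact_comp.
  rewrite mem_undup; apply/flattenP.
  exists [seq pair_comp (a i, b i) p | p <- W i]; last exact: map_f.
  by apply: map_f; rewrite mem_enum.
- move=> _ _ /VP[i [p pW ->]] /VP[j [p' pW' ->]] pp' x y Kx Ky.
  have [[_ _ Wi] _ sepi] := HW i; have [[_ _ Wj] _ _] := HW j.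
  rewrite !pact_comp; have [ij|ij] := eqVneq i j; last first.
    have := hd0 (i, j) ij _ _ (Wi p pW x Kx) (Wj p' pW' y Ky).
    by apply: le_trans; rewrite ler_piMr// ltW.
  rewrite -ij in pp' pW' *; rewrite pactB l2normZ gtr0_norm ?a0//=.
  rewrite [leRHS]mulrC -ler_pdivrMr ?a0//.
  rewrite -mulrA; apply: sepi => //.
  by apply: contraNneq pp' => ->.
Qed.

(** Selection of pieces of size [q] for which the images of the base point [x0]
    form a maximal separated set as seen in the direction [e]. *)
Lemma cut_out_net K e (lam d0 D L q : R) W (x0 : E) : cut_out K lam d0 q W ->
  sphere R n e -> K x0 -> (forall x y, K x -> K y -> l2norm (x - y) <= D) ->
  0 < lam -> 0 < q -> 0 <= L ->
  exists U, [/\ piece_family K lam q U,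
    forall p p', p \in U -> p' \in U -> p != p' -> forall x y, K x -> K y ->
      (L - 2 * D) * q <= perp_norm e (pact p x - pact p' y) &
    forall x, K x -> exists2 p, p \in U &
      perp_norm e (pact p x0 - x) <= (L + D) * q].
Proof.
move=> [[uW Wq WK] Wcov _] e1 Kx0 KD lam0 q0 L0.
pose r p p' := perp_norm e (pact p x0 - pact p' x0) <= L * q.
have rr : reflexive r by move=> p; rewrite /r subrr perp_norm0 mulr_ge0// ltW.
have rs : symmetric r by move=> p p'; rewrite /r perp_norm_distC.
have near p x y : p \in W -> K x -> K y ->
    perp_norm e (pact p x - pact p y) <= D * q.
  move=> pW Kx Ky; have /andP[qp pq] := Wq p pW.
  have p0 : 0 < p.1 by rewrite (lt_le_trans _ qp)// mulr_gt0.
  rewrite pactB perp_normZ gtr0_norm// mulrC ler_pM// ?perp_norm_ge0 ?(ltW p0)//.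
  by rewrite (le_trans (perp_norm_le _ e1))// KD.
have [U [uU UW Usep Ucov]] := maximal_unrelated W rr rs.
exists U; split.
- by split => // p /UW; [exact: Wq|exact: WK].
- move=> p p' pU pU' pp' x y Kx Ky; have := Usep p p' pU pU' pp'.
  rewrite -ltNge mulrBl -mulrA; apply: perp_norm_moved; exact: near (UW _ _) _ _.
- move=> x /Wcov[p pW [y Ky ->]]; have [p' pU' pp'] := Ucov p pW.
  exists p' => //; rewrite mulrDl perp_norm_distC.
  rewrite [leRHS]addrC; apply: le_trans (perp_norm_triangle e (pact p x0) _ _) _.
  exact: lerD (near p y x0 pW Ky Kx0) pp'.
Qed.

End piece_families.

(** * Counting close pairs *)

Section counting.
Local Open Scope nat_scope.

Lemma sum_pred1_eq (C : finType) (x : C) : \sum_(j : C) (x == j) = 1.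
Proof.
rewrite (bigD1 x)//= eqxx big1// => j jx.
by rewrite eq_sym (negbTE jx).
Qed.

(** Cauchy-Schwarz: a map to [C] identifies at least [#|O| ^ 2 / #|C|] pairs. *)
Lemma card_sqr_le_pairs (O C : finType) (g : O -> C) :
  #|O| ^ 2 <= #|C| * \sum_(x : O) \sum_(y : O) (g x == g y).
Proof.
pose k (j : C) := \sum_(x : O) (g x == j).
have cardO : #|O| = \sum_(j : C) k j.
  rewrite exchange_big/= -sum1_card; apply: eq_bigr => x _.
  by rewrite sum_pred1_eq.
have pairsE : \sum_(x : O) \sum_(y : O) (g x == g y) = \sum_(j : C) k j ^ 2.
  under [RHS]eq_bigr => j _ do rewrite -mulnn big_distrlr/=.
  rewrite [RHS]exchange_big; apply: eq_bigr => x _.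
  rewrite [RHS]exchange_big; apply: eq_bigr => y _ /=.
  rewrite (bigD1 (g x))//= eqxx mul1n big1 ?addn0; first by rewrite eq_sym.
  by move=> j jx; rewrite [g x == j]eq_sym (negbTE jx).
rewrite pairsE cardO -(leq_pmul2r (isT : 0 < 2)).
rewrite -mulnn big_distrlr/= big_distrl/=.
apply: (@leq_trans (\sum_(i : C) \sum_(j : C) (k i ^ 2 + k j ^ 2))).
  apply: leq_sum => i _; rewrite big_distrl/=; apply: leq_sum => j _.
  by rewrite mulnC; exact: nat_Cauchy.
under eq_bigr do rewrite big_split/= sum_nat_const.
by rewrite big_split/= sum_nat_const -big_distrr/= addnn -muln2.
Qed.

Lemma sum_bool_le1 (C : finType) (P : pred C) :
  (forall x y, P x -> P y -> x = y) -> \sum_(x : C) P x <= 1.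
Proof.
move=> H; have [[x Px]|nP] := pselect (exists x, P x).
  rewrite (bigD1 x)//= Px big1// => y yx.
  by case: (boolP (P y)) => // Py; rewrite (H y x) ?eqxx in yx.
by rewrite big1// => x _; case: (boolP (P x)) => // Px; case: nP; exists x.
Qed.

(** Points are indexed by [I * J * L], and [c d] is closeness in the direction
    [d : D]. Distinct points with the same first index are never close, points
    with distinct first indices are close in at most one direction, and closeness
    in some direction to a given point determines the middle index from the two
    other ones. *)
Lemma sum_close_pairs (D I J L : finType)
    (c : D -> I * J * L -> I * J * L -> bool) :
  (forall d x y, c d x y -> x.1.1 = y.1.1 -> x = y) ->
  (forall d d' x y, c d x y -> c d' x y -> x.1.1 <> y.1.1 -> d = d') ->
  (forall d d' x i j j' l, c d x (i, j, l) -> c d' x (i, j', l) -> j = j') ->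
  \sum_(d : D) \sum_x \sum_y c d x y <=
    #|D| * (#|I| * #|J| * #|L|) + (#|I| * #|J| * #|L|) * (#|I| * #|L|).
Proof.
move=> same diff mid.
apply: (@leq_trans (\sum_(d : D) \sum_(x : I * J * L) \sum_(y : I * J * L)
    ((x == y) + (c d x y && (x.1.1 != y.1.1))))).
  apply: leq_sum => d _; apply: leq_sum => x _; apply: leq_sum => y _.
  case: (boolP (c d x y)) => //= cxy.
  case: (eqVneq x.1.1 y.1.1) => [e|_]; last exact: leq_addl.
  by rewrite (same d x y cxy e) eqxx.
under eq_bigr do under eq_bigr do rewrite big_split/= sum_pred1_eq.
under eq_bigr do rewrite big_split/= sum_nat_const muln1 !card_prod.
rewrite big_split/= sum_nat_const leq_add2l.
have -> : (#|I| * #|J| * #|L|) * (#|I| * #|L|) =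
    \sum_(x : I * J * L) \sum_(i : I) \sum_(l : L) 1.
  by rewrite !sum_nat_const !card_prod muln1.
rewrite exchange_big/=.
apply: leq_sum => x _; rewrite exchange_big/=.
apply: (@leq_trans (\sum_(y : I * J * L) [exists d, c d x y])).
  apply: leq_sum => y _.
  case: (boolP [exists d, c d x y]) => [_|/existsPn nd].
    apply: sum_bool_le1 => d d' /andP[cd /eqP xy] /andP[cd' _].
    exact: diff cd cd' xy.
  by rewrite big1// => d _; rewrite (negbTE (nd d)).
rewrite (eq_bigr (fun y => nat_of_bool [exists d, c d x (y.1.1, y.1.2, y.2)]));
  last by move=> [[i j] l] _.
rewrite -(pair_bigA _
  (fun ij l => nat_of_bool [exists d, c d x (ij.1, ij.2, l)]))/=.
rewrite -(pair_bigA _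
  (fun i j => \sum_l nat_of_bool [exists d, c d x (i, j, l)]))/=.
apply: leq_sum => i _; rewrite exchange_big/=; apply: leq_sum => l _.
apply: sum_bool_le1 => j j' /existsP[d cd] /existsP[d' cd']; exact: mid cd cd'.
Qed.

End counting.

(** * Entropy of a set of directions *)

Section direction_counting.
Context {R : realType} {n : nat}.
Local Notation E := (euclidean R n).
Implicit Types (K : set E) (e x y : E) (p : R * E) (U W : seq (R * E)).

(** The double counting of close pairs at scale [delta = tau q ^ 2]. The points
    are the [pact v (pact u (pact z x0))] with [v] in [W] (size [tau]) and [u],
    [z] in [U] (size [q], separated in the direction [e0]); [c] is a separated
    set of directions within [tau q] of [e0]; the projection of [K] along each
    element of [c] is covered by at most [M] balls of radius [(3 D + 1) delta].
    Two points in the same ball are at distance at most [B delta]; the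
    separation constants of [U] and of [c] are those that make points with the
    same first index, respectively directions in which two points with distinct
    first indices are close, coincide. *)
Lemma direction_count K (x0 e0 : E) (D lam d0 tau q M : R) W U (c : seq E) :
  let B := 6 * D + 2 in
  0 <= M -> K x0 -> 1 <= D -> (forall x y, K x -> K y -> l2norm (x - y) <= D) ->
  0 < lam < 1 -> 0 < d0 -> 0 < tau <= 1 -> 0 < q ->
  2 * (tau * q) <= 1 -> B * q <= 1 -> 8 * B * q ^+ 2 < d0 ->
  cut_out K lam d0 tau W -> sphere R n e0 ->
  piece_family K lam q U ->
  (forall p p', p \in U -> p' \in U -> p != p' -> forall x y, K x -> K y ->
    (2 * D + (B + 1) / lam ^+ 2) * q <= perp_norm e0 (pact p x - pact p' y)) ->
  uniq c -> (forall e, e \in c -> sphere R n e) ->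
  (forall e, e \in c -> l2norm (e - e0) <= tau * q) ->
  (forall e f, e \in c -> f \in c -> e != f ->
    8 * B / d0 * q ^+ 2 < l2norm (e - f)) ->
  (forall e, e \in c -> exists2 C : seq (R * E), (size C)%:R <= M &
    forall x, K x -> exists2 p, p \in C &
      perp_norm e (pact p x0 - x) <= (3 * D + 1) * (tau * q ^+ 2)) ->
  (size c)%:R * ((size W)%:R * (size U)%:R * (size U)%:R) ^+ 2 <=
    M * ((size c)%:R * ((size W)%:R * (size U)%:R * (size U)%:R) +
         (size W)%:R ^+ 2 * (size U)%:R ^+ 3).
Proof.
move=> B M0 Kx0 D1 KD /andP[lam0 lam1] d00 /andP[tau0 tau1] q0 r1 Bq Bd.
move=> [[uW Wtau WK] _ Wsep] e01 [uU Uq UK] Usep uc c1 ce0 csep ccov.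
pose w (i : 'I_(size W)) := nth (0, 0) W i.
pose u (j : 'I_(size U)) := nth (0, 0) U j.
pose dir (k : 'I_(size c)) := nth 0 c k.
have wW i : w i \in W by exact: mem_nth.
have uiU j : u j \in U by exact: mem_nth.
have dc k : dir k \in c by exact: mem_nth.
have w_inj : injective w.
  by move=> i i' /eqP; rewrite nth_uniq// => /eqP/val_inj.
have u_inj : injective u.
  by move=> i i' /eqP; rewrite nth_uniq// => /eqP/val_inj.
have dir_inj : injective dir.
  by move=> i i' /eqP; rewrite nth_uniq// => /eqP/val_inj.
pose O := ('I_(size W) * 'I_(size U) * 'I_(size U))%type.
pose X (o : O) := pact (w o.1.1) (pact (u o.1.2) (pact (u o.2) x0)).
have KX0 l : K (pact (u l) x0) by exact: UK.
have KX1 j l : K (pact (u j) (pact (u l) x0)) by exact: UK.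
have KX o : K (X o) by exact: WK.
pose delta := tau * q ^+ 2.
pose r := tau * q.
have r0 : 0 < r by rewrite mulr_gt0.
have delta0 : 0 < delta by rewrite mulr_gt0// exprn_gt0.
have B0 : 0 < B by rewrite /B; lra.
have B1p : 0 < B + 1 by rewrite ltr_wpDl ?ltW.
have Bdelta : B * delta <= r.
  have -> : B * delta = (B * q) * r by rewrite /delta /r; ring.
  by rewrite ler_piMl// ltW.
pose close (k : 'I_(size c)) (o o' : O) : bool :=
  perp_norm (dir k) (X o - X o') <= B * delta.
(* Closeness in a direction near [e0] is almost closeness in [e0]. *)
have close0 k o o' : close k o o' ->
    perp_norm e0 (X o - X o') <= (2 * D + 1) * r.
  move=> ck; have := perp_norm_dir (X o - X o') e01 (c1 _ (dc k)).
  have := ce0 _ (dc k); rewrite l2norm_distC -/r => h1.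
  have h2 := KD _ _ (KX o) (KX o').
  have : l2norm (X o - X o') * l2norm (e0 - dir k) <= D * r.
    by rewrite ler_pM ?l2norm_ge0.
  by move: ck; rewrite /close; lra.
have lam2 : 0 < lam ^+ 2 by rewrite exprn_gt0.
have wpos i : lam * tau <= (w i).1 by case/andP: (Wtau _ (wW i)).
have upos j : lam * q <= (u j).1 by case/andP: (Uq _ (uiU j)).
(* Distinct middle indices are visible at scale [r] in the direction [e0]. *)
have mid_far i j j' y y' : K y -> K y' -> j <> j' ->
    (2 * (2 * D + 1)) * r <
    perp_norm e0 (pact (w i) (pact (u j) y) - pact (w i) (pact (u j') y')).
  move=> Ky Ky' jj'.
  have jj : u j != u j' by apply/eqP => /u_inj.
  have h := Usep _ _ (uiU j) (uiU j') jj _ _ Ky Ky'.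
  have w0 : 0 < (w i).1 by rewrite (lt_le_trans _ (wpos i))// mulr_gt0.
  rewrite pactB perp_normZ gtr0_norm//.
  have h1 : (B + 1) * q / lam <= perp_norm e0 (pact (u j) y - pact (u j') y').
    apply: le_trans h.
    have : (B + 1) / lam <= (B + 1) / lam ^+ 2.
      rewrite ler_pM2l; last by rewrite ltr_wpDl ?ltW.
      by rewrite lef_pV2 ?posrE// expr2 ler_piMr// ltW.
    rewrite mulrAC => h2; rewrite ler_wpM2r ?(ltW q0)//.
    by rewrite (le_trans h2)// lerDr; lra.
  have h2 : lam * tau * ((B + 1) * q / lam) = (B + 1) * r.
    by rewrite /r; field; rewrite gt_eqF.
  apply: (@lt_le_trans _ _ ((B + 1) * r)).
    by rewrite ltr_pM2r// /B; lra.
  rewrite -h2; apply: ler_pM => //; first by rewrite mulr_ge0// ltW.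
  by rewrite divr_ge0 ?mulr_ge0// ?ltW//; lra.
(* For equal first indices the middle ones agree by [mid_far]; the last ones
   agree since [U] is separated at scale [q], hence its image by
   [pact (w i) \o pact (u j)] at scale [delta], also in the direction [dir k]
   as it is within [q] of [e0]. *)
have same k o o' : close k o o' -> o.1.1 = o'.1.1 -> o = o'.
  move: o o' => [[i j] l] [[i' j'] l'] ck /= ii'; subst i'.
  have h0 := close0 _ _ _ ck.
  have jj : j = j'.
    apply: contrapT => jj; have := mid_far i j j' _ _ (KX0 l) (KX0 l') jj.
    have : 0 < (2 * D + 1) * r by rewrite mulr_gt0//; lra.
    by move: h0; rewrite /X/=; lra.
  subst j'; congr (_, _); apply: contrapT => ll.
  have ul : u l != u l' by apply/eqP => /u_inj.
  have h := Usep _ _ (uiU l) (uiU l') ul _ _ Kx0 Kx0.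
  have := perp_norm_dir (pact (u l) x0 - pact (u l') x0) e01 (c1 _ (dc k)).
  have h1 :
      l2norm (pact (u l) x0 - pact (u l') x0) * l2norm (e0 - dir k) <= D * q.
    rewrite ler_pM ?l2norm_ge0 ?KD// l2norm_distC (le_trans (ce0 _ (dc k)))//.
    by rewrite ler_piMl// ltW.
  move=> h2.
  have h3 : (B + 1) / lam ^+ 2 * q <=
      perp_norm (dir k) (pact (u l) x0 - pact (u l') x0).
    by move: h h2 h1; rewrite mulrDl; clear; lra.
  move: ck; rewrite /close /X/= !pactB !perp_normZ.
  have w0 : 0 < (w i).1 by rewrite (lt_le_trans _ (wpos i))// mulr_gt0.
  have u0 : 0 < (u j).1 by rewrite (lt_le_trans _ (upos j))// mulr_gt0.
  rewrite !gtr0_norm// leNgt => /negP; apply.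
  apply: (@lt_le_trans _ _ ((B + 1) * delta)).
    by rewrite ltr_pM2r// ltrDl.
  have -> : (B + 1) * delta =
      (lam * tau) * ((lam * q) * ((B + 1) / lam ^+ 2 * q)).
    by rewrite /delta; field; rewrite gt_eqF.
  have B1 : 0 <= (B + 1) / lam ^+ 2 * q.
    by rewrite mulr_ge0 ?(ltW q0)// divr_ge0 ?(ltW B1p) ?(ltW lam2).
  have lq0 : 0 <= lam * q by rewrite mulr_ge0 ?(ltW lam0) ?(ltW q0).
  apply: ler_pM => //; last exact: ler_pM.
    by rewrite mulr_ge0 ?(ltW lam0) ?(ltW tau0).
  exact: mulr_ge0.
(* Points in distinct pieces of size [tau] are at distance at least [d0 tau], so
   that [sphere_close] applies. *)
have diff k k' o o' :
    close k o o' -> close k' o o' -> o.1.1 <> o'.1.1 -> k = k'.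
  move=> ck ck' ii; apply: contrapT => kk.
  have ww : w o.1.1 != w o'.1.1 by apply/eqP => /w_inj.
  have h := Wsep _ _ (wW _) (wW _) ww _ _ (KX1 o.1.2 o.2) (KX1 o'.1.2 o'.2).
  rewrite -/(X o) -/(X o') in h.
  have dd : dir k != dir k' by apply/eqP => /dir_inj.
  have := csep _ _ (dc k) (dc k') dd; rewrite ltNge => /negP; apply.
  have kk1 : l2norm (dir k - dir k') <= 1.
    have := ce0 _ (dc k); have := ce0 _ (dc k').
    have := l2normB (dir k - e0) (dir k' - e0).
    by rewrite opprB addrA subrK; lra.
  have hB : 8 * (B * delta) < d0 * tau.
    have -> : 8 * (B * delta) = 8 * B * q ^+ 2 * tau by rewrite /delta; ring.
    by rewrite ltr_pM2r.
  have h1 := sphere_close (c1 _ (dc k)) (c1 _ (dc k')) kk1 ck ck'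
    (lt_le_trans hB h).
  have : d0 * tau * l2norm (dir k - dir k') <= 8 * (B * delta).
    by apply: le_trans h1; rewrite ler_wpM2r ?l2norm_ge0.
  rewrite mulrC -ler_pdivlMr ?mulr_gt0//.
  suff -> : 8 * (B * delta) / (d0 * tau) = 8 * B / d0 * q ^+ 2 by [].
  by rewrite /delta; field; rewrite !gt_eqF.
have mid k k' o i j j' l :
    close k o (i, j, l) -> close k' o (i, j', l) -> j = j'.
  move=> /close0 ck /close0 ck'; apply: contrapT => jj.
  have far := mid_far i j j' _ _ (KX0 l) (KX0 l) jj.
  have tri := perp_norm_triangle e0 (X o) (X (i, j, l)) (X (i, j', l)).
  rewrite (perp_norm_distC e0 (X (i, j, l)) (X o)) in tri.
  move: far; rewrite ltNge => /negP; apply; apply: (le_trans tri).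
  rewrite -mulrA mulr_natl mulr2n; exact: lerD ck ck'.
have H := sum_close_pairs same diff mid.
(* Points assigned to the same ball of the cover for [dir k] are close. *)
have Hk k : ((size W)%:R * (size U)%:R * (size U)%:R) ^+ 2 <=
    M * (\sum_x \sum_y close k x y)%:R.
  have [C CM Ccov] := ccov _ (dc k).
  have /choice[g gP] : forall o : O, exists j : 'I_(size C),
      perp_norm (dir k) (pact (nth (0, 0) C j) x0 - X o) <= (3 * D + 1) * delta.
    move=> o; have [p pC hp] := Ccov _ (KX o).
    have ip : (index p C < size C)%N by rewrite index_mem.
    by exists (Ordinal ip); rewrite /= nth_index.
  have := card_sqr_le_pairs g; rewrite !card_prod !card_ord -(ler_nat R).
  rewrite natrX !natrM => /le_trans; apply; apply: ler_pM => //.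
  rewrite ler_nat; apply: leq_sum => x _; apply: leq_sum => y _.
  case: eqVneq => //= gxy; rewrite lt0b /close.
  apply: le_trans (perp_norm_triangle _ (pact (nth (0, 0) C (g x)) x0) _ _) _.
  have -> : B * delta = (3 * D + 1) * delta + (3 * D + 1) * delta.
    by rewrite /B; ring.
  rewrite perp_norm_distC; apply: lerD; first exact: gP.
  rewrite gxy; exact: gP.
rewrite mulr_natl -[X in _ *+ X]card_ord -sumr_const.
rewrite (le_trans (ler_sum _ (fun k _ => Hk k)))// -mulr_sumr.
rewrite ler_wpM2l// -natr_sum.
move: H; rewrite !card_ord -(ler_nat R) => /le_trans; apply.
rewrite natrD !natrM lerD2l.
move: (size W)%:R (size U)%:R => v z.
by have -> : v ^+ 2 * z ^+ 3 = v * z * z * (v * z) by ring.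
Qed.

End direction_counting.

Section direction_entropy.
Context {R : realType} {n : nat}.
Local Notation E := (euclidean R n).
Implicit Types (K : set E) (e x y : E) (c : seq E).

(** Directions in which the projection of [K] has dimension at most [s1], while
    covering it with balls of radius [delta < delta1] takes at least
    [delta ^ (- s0)] balls. *)
Definition direction_stratum K (s0 s1 delta1 : R) : set E :=
  [set e | [/\ sphere R n e,
    (hausdorff_dim (proj_perp e @` K) <= s1%:E)%E &
    forall delta c, 0 < delta < delta1 ->
      (forall x, (proj_perp e @` K) x ->
        exists2 y, y \in c & mdist y x <= delta) ->
      delta `^ (- s0) <= (size c)%:R]].

(** A set of directions of the stratum that lies in a ball of radius
    [q ^ (1 + theta)] and is separated at distance [C1 q ^ 2] has at most
    [C q ^ (s0 - (2 + theta) s1)] elements. The pieces of size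
    [tau = q ^ theta] number at least of the order of [tau ^ (- t)]; as
    [t > s1], they make the number of points used in [direction_count] large compared with the
    number of balls that cover a projection, although the bounds [s0] and [s1]
    on the dimension differ. *)
Lemma direction_entropy K (lam d0 s0 s1 t theta delta1 : R) :
  compact K -> K !=set0 -> 0 < lam < 1 -> 0 < d0 ->
  (forall q, 0 < q <= 1 -> exists W, cut_out K lam d0 q W) ->
  0 <= s0 -> 0 <= s1 -> s1 < t -> (t%:E < hausdorff_dim K)%E -> 0 < theta ->
  2 * (s1 - s0) < theta * (t - s1) -> 0 < delta1 ->
  exists C C1 q1, [/\ 0 <= C, 0 < C1, 0 < q1 & forall q e0 c, 0 < q < q1 ->
    direction_stratum K s0 s1 delta1 e0 -> uniq c ->
    (forall e, e \in c -> direction_stratum K s0 s1 delta1 e) ->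
    (forall e, e \in c -> l2norm (e - e0) <= q `^ (1 + theta)) ->
    (forall e f, e \in c -> f \in c -> e != f ->
      C1 * q ^+ 2 < l2norm (e - f)) ->
    (size c)%:R <= C * q `^ (s0 - (2 + theta) * s1)].
Proof.
move=> cK K0 /andP[lam0 lam1] d00 cuts s00 s10 s1t tK theta0 gap delta10.
have [x0 Kx0] := K0.
have [D D1 KD] := compact_l2norm_bounded cK.
have D0 : 0 < D by apply: lt_le_trans D1.
pose B := 6 * D + 2.
have B0 : 0 < B by rewrite /B; lra.
pose L := 4 * D + (B + 1) / lam ^+ 2.
have lam20 : 0 < lam ^+ 2 by rewrite exprn_gt0.
have L0 : 0 < L by rewrite /L addr_gt0 ?divr_gt0//; lra.
pose G := L + D.
have G0 : 0 < G by rewrite addr_gt0.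
have t0 : 0 < t by rewrite (le_lt_trans s10).
have [dK dK0 HK] := hausdorff_dim_gt_cover (ltW t0) tK.
have [qa qa0 hqa] := powR_small (2 * D / dK) theta0.
have [qb qb0 hqb] := powR_small 2 (addr_gt0 ltr01 theta0).
pose eta := theta * (t - s1) - 2 * (s1 - s0).
have eta0 : 0 < eta by rewrite subr_gt0.
pose Cm := 2 * lam `^ (- s1) * D `^ t * G `^ (2 * s0).
have [qc qc0 hqc] := powR_small Cm eta0.
pose q1 := Num.min qa (Num.min qb (Num.min qc (Num.min 1
  (Num.min (delta1 / G) (Num.min B^-1 (d0 / (8 * B))))))).
pose C := 2 * lam `^ (- s1) * G `^ s0.
exists C, (8 * B / d0), q1; split.
- by rewrite !mulr_ge0 ?powR_ge0.
- by rewrite divr_gt0 ?mulr_gt0.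
- by rewrite !lt_min qa0 qb0 qc0 ltr01 invr_gt0 B0 !divr_gt0 ?mulr_gt0.
move=> q e0 c /andP[q0].
rewrite !lt_min => /andP[qqa /and5P[qqb qqc q11 qdelta]].
move=> /andP[qB qd] [e01 _ e0cov] uc cstr ce0 csep.
have q01 : 0 < q <= 1 by rewrite q0 ltW.
pose tau := q `^ theta.
have tau0 : 0 < tau by rewrite powR_gt0.
have tau1 : tau <= 1 by rewrite -(powRr0 q) ger_powR// ltW.
have tau01 : 0 < tau <= 1 by rewrite tau0.
have tauq : tau * q = q `^ (1 + theta).
  by rewrite powRDp// powRr1 ?(ltW q0)// mulrC.
pose delta := tau * q ^+ 2.
have delta0 : 0 < delta by rewrite mulr_gt0// exprn_gt0.
have deltaE : delta = q `^ (2 + theta).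
  by rewrite powRDp// powR_mulrn ?(ltW q0)// mulrC.
have delta1' : delta <= 1.
  have th2 : 0 <= 2 + theta by rewrite addr_ge0// ltW.
  rewrite deltaE -[leRHS](powRr0 q); exact: (ger_powR q01 th2).
have r2 : 2 * (tau * q) <= 1 by rewrite tauq hqb// q0.
have Bq : B * q <= 1 by rewrite mulrC -ler_pdivlMr// div1r ltW.
have Bd : 8 * B * q ^+ 2 < d0.
  rewrite mulrC -ltr_pdivlMr ?mulr_gt0// (le_lt_trans _ qd)//.
  by rewrite expr2 ler_piMl ?(ltW q0)// ltW.
have [W cW] := cuts tau tau01.
have [Wq cWq] := cuts q q01.
have [U [famU Usep Ucov]] := cut_out_net cWq e01 Kx0 KD lam0 q0 (ltW L0).
have LB : (L - 2 * D) = 2 * D + (B + 1) / lam ^+ 2 by rewrite /L; ring.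
rewrite LB in Usep.
pose M := (lam * delta) `^ (- s1).
have M0 : 0 <= M by exact: powR_ge0.
have ldelta : 0 < lam * delta < 1.
  by rewrite mulr_gt0//= (le_lt_trans _ lam1)// ler_piMr// ltW.
have delta01 : 0 < delta <= 1 by rewrite delta0.
have L10 : 0 <= 2 * D + 1 by rewrite addr_ge0// mulr_ge0// ltW.
have ccov e : e \in c -> exists2 C : seq (R * E), (size C)%:R <= M &
    forall x, K x -> exists2 p, p \in C &
      perp_norm e (pact p x0 - x) <= (3 * D + 1) * (tau * q ^+ 2).
  move=> /cstr[e1 dime _]; have [We cWe] := cuts delta delta01.
  have [V [[uV Vq VK] Vsep Vcov]] := cut_out_net cWe e1 Kx0 KD lam0 delta0 L10.
  exists V; last first.
    move=> x /Vcov[p pV hp]; exists p => //; apply: le_trans hp _.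
    by have -> : 2 * D + 1 + D = 3 * D + 1 by ring.
  apply: (separated_pieces_card cK K0 e1 ldelta delta0 s10 dime uV) => //.
    by move=> p /Vq /andP[].
  move=> p p' pV pV' pp' x y Kx Ky.
  apply: le_trans (Vsep _ _ pV pV' pp' x y Kx Ky).
  by have -> : 2 * D + 1 - 2 * D = 1; [ring|rewrite mul1r].
have c1 e : e \in c -> sphere R n e by move=> /cstr[].
rewrite -tauq in ce0.
have lam01 : 0 < lam < 1 by rewrite lam0.
have main := @direction_count R n K x0 e0 D lam d0 tau q M W U c M0 Kx0 D1 KD
  lam01 d00 tau01 q0 r2 Bq Bd cW e01 famU Usep uc c1 ce0 csep ccov.
have sizeW : (D * tau) `^ (- t) <= (size W)%:R.
  have [[uW Wt WK] Wcov _] := cW.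
  rewrite -(size_map (pact^~ x0) W); apply: HK.
    rewrite mulr_gt0//=.
    have : 2 * D / dK * tau <= 1 by apply: hqa; rewrite q0.
    rewrite mulrAC ler_pdivrMr// mul1r -mulrA => h.
    by have Dtau := mulr_gt0 D0 tau0; clear -h Dtau; lra.
  move=> x /Wcov[p pW [y Ky ->]]; exists (pact p x0); first exact: map_f.
  rewrite /mdist/= pactB l2normZ mulrC; have /andP[p0 pt] := Wt p pW.
  have pp : 0 < p.1 by rewrite (lt_le_trans _ p0)// mulr_gt0.
  by rewrite gtr0_norm// ler_pM ?l2norm_ge0 ?KD// ltW.
have sizeU : (G * q) `^ (- s0) <= (size U)%:R.
  rewrite -(size_map (fun p => proj_perp e0 (pact p x0)) U); apply: e0cov.
    by rewrite mulr_gt0//= mulrC -ltr_pdivlMr.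
  move=> _ [x Kx <-]; have [p pU hp] := Ucov x Kx.
  exists (proj_perp e0 (pact p x0)).
    exact: (map_f (fun p => proj_perp e0 (pact p x0))).
  by rewrite /mdist/= -proj_perpB.
move: main sizeW sizeU.
have N00 : 0 <= (size c)%:R :> R by [].
move: ((size c)%:R : R) N00 ((size W)%:R : R) ((size U)%:R : R).
move=> N N0 v u main sizeW sizeU.
have v0 : 0 < v by rewrite (lt_le_trans _ sizeW)// powR_gt0// mulr_gt0.
have u0 : 0 < u by rewrite (lt_le_trans _ sizeU)// powR_gt0// mulr_gt0.
have ME : M = lam `^ (- s1) * q `^ (- ((2 + theta) * s1)).
  by rewrite /M powRM ?(ltW lam0) ?(ltW delta0)// deltaE -powRrM mulrN.
have th2E : q `^ (- ((2 + theta) * s1)) = (q `^ ((2 + theta) * s1))^-1.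
  exact: powRN.
have etaE :
    q `^ eta = q `^ (theta * t) * q `^ s0 ^+ 2 / q `^ ((2 + theta) * s1).
  rewrite -th2E expr2 -!powRDp//; congr (_ `^ _); rewrite /eta; ring.
have gammaE : q `^ (s0 - (2 + theta) * s1) = q `^ s0 / q `^ ((2 + theta) * s1).
  by rewrite powRDp// th2E.
have G2 : G `^ (2 * s0) = G `^ s0 ^+ 2.
  by rewrite expr2 -powRDp// mulr2n mulrDl mul1r.
have /hqc : 0 < q < qc by rewrite q0.
rewrite etaE /Cm G2 => {}hqc.
rewrite gammaE /C.
have sizeW' : (D `^ t * q `^ (theta * t))^-1 <= v.
  apply: le_trans sizeW.
  by rewrite powRN powRM ?(ltW D0) ?(ltW tau0)// -powRrM.
have sizeU' : (G `^ s0 * q `^ s0)^-1 <= u.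
  apply: le_trans sizeU.
  by rewrite powRN powRM ?(ltW G0) ?(ltW q0).
have : 0 < D `^ t /\ 0 < G `^ s0 /\ 0 < lam `^ (- s1) by rewrite !powR_gt0.
have : 0 < q `^ (theta * t) /\ 0 < q `^ s0 /\ 0 < q `^ ((2 + theta) * s1).
  by rewrite !powR_gt0.
move: ME main hqc sizeW' sizeU' v0 u0; rewrite th2E.
clear -N0.
move: (D `^ t) (G `^ s0) (lam `^ (- s1)) (q `^ (theta * t)) (q `^ s0)
  (q `^ ((2 + theta) * s1)) => a g l x y z.
move=> -> main small vlow ulow v0 u0 [x0 [y0 z0]] [a0 [g0 l0]].
have [ax gy] : 0 < a * x /\ 0 < g * y by rewrite !mulr_gt0.
(* The number [v u ^ 2] of points is at least twice the number [l / z] of balls,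
   so that the diagonal pairs account for at most half of the close pairs. *)
have h1 : 2 * (l / z) <= v * u * u.
  apply: (@le_trans _ _ ((a * x)^-1 * (g * y)^-1 * (g * y)^-1)).
    rewrite -!invfM -[leRHS]div1r ler_pdivlMr ?mulr_gt0//.
    apply: le_trans small; rewrite le_eqVlt; apply/orP; left; apply/eqP.
    by field; rewrite gt_eqF.
  have igy : 0 <= (g * y)^-1 by rewrite invr_ge0 ltW.
  have iax : 0 <= (a * x)^-1 by rewrite invr_ge0 ltW.
  by apply: ler_pM => //; [rewrite mulr_ge0|apply: ler_pM].
have lz0 : 0 < l / z by rewrite divr_gt0.
have h2 : N * u <= 2 * (l / z).
  have P0 : 0 < v ^+ 2 * u ^+ 3 by rewrite mulr_gt0 ?exprn_gt0.
  rewrite -(ler_pM2r P0).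
  have h3 : (l / z) * (N * (v * u * u)) <= 2^-1 * (N * (v * u * u) ^+ 2).
    have -> : 2^-1 * (N * (v * u * u) ^+ 2) =
      (2^-1 * (v * u * u)) * (N * (v * u * u)) by ring.
    have P1 : 0 < v * u * u by rewrite !mulr_gt0.
    by rewrite ler_wpM2r ?(mulr_ge0 N0 (ltW P1))// ler_pdivlMl.
  have -> : N * u * (v ^+ 2 * u ^+ 3) = N * (v * u * u) ^+ 2 by ring.
  move: main h3; rewrite mulrDr -(mulrA 2).
  move: (N * (v * u * u) ^+ 2) (l / z * (N * (v * u * u))) => p1 p2.
  by move: (l / z * (v ^+ 2 * u ^+ 3)) => p3 p13 p21; clear -p13 p21; lra.
have h4 : N <= 2 * (l / z) / u by rewrite ler_pdivlMr.
apply: (le_trans h4).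
have -> : 2 * l * g * (y / z) = 2 * (l / z) * (g * y).
  by field; rewrite gt_eqF.
rewrite ler_pM2l ?mulr_gt0 ?invr_gt0//.
by rewrite -[leRHS]invrK lef_pV2 ?posrE ?invr_gt0.
Qed.

End direction_entropy.

(** * Exceptional directions *)

Section exceptional_directions.
Context {R : realType} {n : nat}.
Local Notation E := (euclidean R n).
Implicit Types (K : set E).

(** The iteration over scales, with [u = q ^ (2 - theta)] as the smaller scale:
    it exceeds [C1 q ^ 2] for small [q], and [q ^ (1 + theta) = u ^ kappa]. *)
Lemma stratum_upper_box_dim K (lam d0 s0 s1 t theta delta1 sigma sigma' : R)
    (F : set (sphere R n)) :
  compact K -> K !=set0 -> 0 < lam < 1 -> 0 < d0 ->
  (forall q, 0 < q <= 1 -> exists W, cut_out K lam d0 q W) ->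
  0 <= s0 -> s0 <= s1 -> s1 < t -> (t%:E < hausdorff_dim K)%E ->
  0 < theta < 2^-1 -> 2 * (s1 - s0) < theta * (t - s1) -> 0 < delta1 ->
  (2 + theta) * s1 - s0 < (1 - 2 * theta) * sigma -> sigma < sigma' ->
  (forall e, F e -> direction_stratum K s0 s1 delta1 (set_val e)) ->
  (upper_box_dim F <= sigma'%:E)%E.
Proof.
move=> cK K0 lam01 d00 cuts s00 s01 s1t tK /andP[th0 th2] gap dl0 hsigma ss' FK.
have s10 : 0 <= s1 := le_trans s00 s01.
have [C [C1 [q1 [C0 C10 q10 H]]]] :=
  direction_entropy cK K0 lam01 d00 cuts s00 s10 s1t tK th0 gap dl0.
have [q2 q20 hq2] := powR_small C1 th0.
have a0 : 0 < 2 - theta by lra.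
have b0 : 0 < 1 - 2 * theta by lra.
pose kappa := (1 + theta) / (2 - theta).
pose gamma := ((2 + theta) * s1 - s0) / (2 - theta).
have g0 : 0 <= (2 + theta) * s1 - s0.
  by have := mulr_ge0 (ltW th0) s10; lra.
have sigma0 : 0 < sigma by rewrite -(pmulr_rgt0 _ b0) (le_lt_trans g0).
have k01 : 0 < kappa < 1.
  rewrite divr_gt0//=; last lra.
  by rewrite ltr_pdivrMr//; lra.
have gamma0 : 0 <= gamma by rewrite divr_ge0// ltW.
have kE : 1 - kappa = (1 - 2 * theta) / (2 - theta).
  by rewrite /kappa; field; rewrite gt_eqF.
have gs : gamma < (1 - kappa) * sigma.
  by rewrite kE mulrAC ltr_pM2r ?invr_gt0.
pose u0 := Num.min q1 q2 `^ (2 - theta).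
have u00 : 0 < u0 by rewrite powR_gt0// lt_min q10.
have [||A hA] := @covered_iteration R _ F kappa gamma sigma C u0
  u00 k01 gamma0 gs C0 _ _.
- by move=> u; exact: sphere_totally_bounded.
- move=> u x /andP[up uu0] Fx.
  apply: covered_separated (ltW up) _ => c [uc csep] cF.
  pose q := u `^ (2 - theta)^-1.
  have qp : 0 < q by rewrite powR_gt0.
  have uE : u = q `^ (2 - theta) by rewrite -powRrM mulVf ?gt_eqF// powRr1// ltW.
  have : q < Num.min q1 q2.
    rewrite ltNge; apply/negP => h.
    have := @ge0_ler_powR R (2 - theta) (ltW a0) (Num.min q1 q2) q.
    rewrite !nnegrE (ltW qp) -uE => /(_ _ isT h).
    by rewrite le_min (ltW q10) (ltW q20) -/u0 leNgt uu0 => /(_ isT).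
  rewrite lt_min => /andP[qq1 qq2].
  have -> : C * u `^ (- gamma) = C * q `^ (s0 - (2 + theta) * s1).
    rewrite uE -powRrM; congr (C * _ `^ _).
    by rewrite /gamma; field; rewrite gt_eqF.
  rewrite -(size_map set_val c); apply: (H q (set_val x)); rewrite ?qp//.
  - exact: FK.
  - by rewrite map_inj_uniq//; exact: val_inj.
  - by move=> _ /mapP[e /cF[Fe _] ->]; exact: FK.
  - move=> _ /mapP[e /cF[_ /= xe] ->]; rewrite l2norm_distC.
    apply: le_trans xe _.
    by rewrite uE -powRrM /kappa mulrCA mulfV ?gt_eqF// mulr1.
  - move=> _ _ /mapP[e ec ->] /mapP[f fc ->] ef.
    have ef' : e != f by apply: contraNneq ef => ->.
    apply: le_lt_trans (csep _ _ ec fc ef').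
    have -> : u = q ^+ 2 * (q `^ theta)^-1.
      by rewrite uE powRDp// powRN -powR_mulrn ?(ltW qp).
    rewrite mulrC ler_wpM2l ?sqr_ge0//.
    rewrite -[leRHS]div1r ler_pdivlMr ?powR_gt0//.
    by apply: hq2; rewrite qp.
apply: (upper_box_dim_le ltr01 (A := A) (sigma := sigma)).
  by rewrite (ltW sigma0).
by move=> u /andP[up u1]; apply: hA; rewrite up ltW.
Qed.

End exceptional_directions.

Theorem proposition1p3 (R : realType) (n : nat) (hn : (1 <= n)%N)
    (N : nat) (a : 'I_N -> R) (b : 'I_N -> euclidean R n)
    (ha : forall i, 0 < a i < 1)
    (K : set (euclidean R n))
    (hK : is_limit_set (fun i => homothety (a i) (b i)) K)
    (hssc : strong_separation (fun i => homothety (a i) (b i)) K)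
    (s : R) (hs0 : 0 <= s) (hs : (s%:E < hausdorff_dim K)%E) :
  (packing_dim [set e : sphere R n |
     hausdorff_dim (proj_perp (set_val e) @` K) <= s%:E] <= s%:E)%E.
Proof.
have [lam [d0 [lam01 d00 cuts]]] := ifs_cut_out ha hK hssc.
have [K0 cK _] := hK.
have [t st tK] : exists2 t, s < t & (t%:E < hausdorff_dim K)%E.
  case: (hausdorff_dim K) hs => [d| |//]; last first.
    by exists (s + 1); rewrite ?ltrDl// ltry.
  by rewrite lte_fin => sd; exists ((s + d) / 2); rewrite ?lte_fin; lra.
apply/lee_addgt0Pr => eps eps0; rewrite -EFinD.
pose sigma := s + eps / 2.
have sigma_gt : s < sigma by rewrite /sigma; lra.
(* The parameters are chosen so that a stratum with [s1 <= s + h] has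
   [(2 + theta) s1 - s0 < (1 - 2 theta) sigma], where [s < sigma < s + eps], and
   so that [2 h < theta (t - s1)]. *)
pose theta := Num.min 4^-1 ((sigma - s) / (2 * (2 * sigma + s))).
have pos : 0 < 2 * (2 * sigma + s) by lra.
have th0 : 0 < theta by rewrite lt_min invr_gt0 ltr0n/= divr_gt0 ?subr_gt0.
have th4 : theta <= 4^-1 by rewrite ge_min lexx.
have ths : theta * (2 * sigma + s) <= (sigma - s) / 2.
  have : theta <= (sigma - s) / (2 * (2 * sigma + s)) by rewrite ge_min lexx orbT.
  by rewrite ler_pdivlMr//; lra.
pose h := Num.min ((sigma - s) / 7) (theta * (t - s) / 4).
have tts0 : 0 < theta * (t - s) by rewrite mulr_gt0// subr_gt0.
have h0 : 0 < h by rewrite lt_min !divr_gt0 ?subr_gt0.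
have h7 : h <= (sigma - s) / 7 by rewrite ge_min lexx.
have ht : h <= theta * (t - s) / 4 by rewrite ge_min lexx orbT.
pose E0 := [set e : sphere R n |
  (hausdorff_dim (proj_perp (set_val e) @` K) <= s%:E)%E].
pose stratum (j m : nat) (e : sphere R n) :=
  direction_stratum K (j%:R * h) (j.+1%:R * h) m.+1%:R^-1 (set_val e).
(* The strata, indexed by [nat] through an enumeration of the pairs [(j, m)];
   the indices that do not encode a relevant pair give the empty set. *)
pose F i : set (sphere R n) := [set e | E0 e /\ exists jm : nat * nat,
  [/\ unpickle i = Some jm, jm.1%:R * h <= s & stratum jm.1 jm.2 e]].
have FE : E0 = \bigcup_i F i.
  rewrite eqEsubset; split; last by move=> e [i _ []].
  move=> e E0e; pose d := hausdorff_dim (proj_perp (set_val e) @` K).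
  have e1 : sphere R n (set_val e) := set_valP e.
  pose P j := `[< (d <= (j.+1%:R * h)%:E)%E >].
  have exP : exists j, P j.
    exists (Num.truncn (s / h)); apply/asboolP; apply: le_trans E0e _.
    by rewrite lee_fin -ler_pdivrMr// ltW// truncnS_gt.
  case: (ex_minnP exP) => -[|j] /asboolP dj jmin.
    exists (pickle (0%N, 0%N)) => //; split=> //; exists (0%N, 0%N).
    rewrite pickleK; split; rewrite ?mul0r//.
    split => // delta c _ cov; rewrite mul0r oppr0 powRr0 ler1n.
    have [x Kx] := K0.
    have [y + _] := cov _ (imageP (proj_perp (set_val e)) Kx).
    by case: c {cov}.
  have jd : ((j.+1%:R * h)%:E < d)%E.
    rewrite ltNge; apply/negP => /asboolP/jmin; by rewrite ltnn.
  have jh0 : 0 <= j.+1%:R * h by rewrite mulr_ge0// ltW.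
  have [dl dl0 hdl] := hausdorff_dim_gt_cover jh0 jd.
  pose m := Num.truncn dl^-1.
  exists (pickle (j.+1, m)) => //; split=> //; exists (j.+1, m).
  rewrite pickleK; split => //=.
    by rewrite -lee_fin (le_trans (ltW jd)).
  split => // delta c /andP[delta0 deltam] cov; apply: hdl cov.
  rewrite delta0/= (lt_trans deltam)// invf_plt ?posrE// truncnS_gt//.
apply: (@le_trans _ _ (ereal_sup (range (fun i => upper_box_dim (F i))))).
  apply: ereal_inf_lbound; exists F => //; split => // i.
  exists 2 => x y _ _; rewrite (le_trans (l2normB _ _))//.
  by rewrite (set_valP x : l2norm _ = _) (set_valP y : l2norm _ = _).
apply: ub_ereal_sup => _ [i _ <-].
have [j [m [jh Fi]]] :
    exists j m, j%:R * h <= s /\ forall e, F i e -> stratum j m e.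
  have [[jm [ui jh]]|no] := pselect (exists jm : nat * nat,
      unpickle i = Some jm /\ jm.1%:R * h <= s).
    exists jm.1, jm.2; split=> // e [_ [jm' [ui' _]]].
    by move: ui'; rewrite ui => -[<-].
  exists 0%N, 0%N; rewrite mul0r; split=> // e [_ [jm [ui jh _]]].
  by case: no; exists jm.
have j1 : j.+1%:R * h = j%:R * h + h by rewrite -natr1 mulrDl mul1r.
have jh0 : 0 <= j%:R * h by rewrite mulr_ge0// ltW.
have m0 : 0 < m.+1%:R^-1 :> R by rewrite invr_gt0.
apply: (@stratum_upper_box_dim R n K lam d0 (j%:R * h) (j.+1%:R * h) t theta
  m.+1%:R^-1 sigma (s + eps)) => //;
  rewrite ?j1; move: (j%:R * h) jh jh0 => x xs x0.
- by rewrite lerDl ltW.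
- nra.
- rewrite th0/=; lra.
- nra.
- nra.
- by rewrite /sigma; lra.
Qed.
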